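(* Let $n\ge 1$ and $X=(x_1,\dots,x_n)$ be independent variables, and let $a,b,c$ be further indeterminates. Then, as formal power series in $x_1,\dots,x_n$ with coefficients depending on $a,b,c$, $$\sum_{\lambda} f_\lambda(a,b,c)\,s_\lambda(X)=\prod_{i=1}^n\frac{1}{(1-ax_i)(1-bx_i)(1-cx_i)}\prod_{1\le j<k\le n}\frac{1}{1-x_jx_k},$$ where the sum is over all partitions $\lambda=(\lambda_1\ge\dots\ge\lambda_n\ge 0)$ of length at most $n$, and $f_\lambda(a,b,c)$ is the polynomial defined in the context.
   Context: $s_\lambda(X)=\det(x_i^{\lambda_j+n-j})_{1\le i,j\le n}/\det(x_i^{n-j})_{1\le i,j\le n}$ is the Schur function. For a partition $\lambda$ of length at most $n$, let $c_j=c_j(\lambda)=\lambda_j-\lambda_{j+1}$ be the number of columns of length $j$ of its Ferrers diagram (with $\lambda_j=0$ for $j>n$), and put $\Gamma(\lambda)=(c_1,c_2,c_3,\dots)$. Let $h_r(a,b,c)$ be the complete homogeneous symmetric polynomial of degree $r$ in $a,b,c$ (with $h_r=0$ for $r<0$). For $r\ge 0$ set $$P_r(a,b,c)=\sum_{k=0}^r\frac{a^{k+1}-b^{k+1}}{a-b}\cdot\frac{1-(ab)^{r-k+1}}{1-ab}\,c^k,\qquad Q_r(a,b,c)=\sum_{k=0}^r h_{r-k}(a,b,c)(abc)^k,$$ (polynomials in $a,b,c$), and $P_r=Q_r=0$ for $r<0$. For an integer sequence $\xi=(\xi_1,\xi_2,\dots)$ with only finitely many nonzero terms set $$F_\xi(a,b,c)=h_{\xi_1}(a,b,c)\prod_{k\ge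 1}P_{\xi_{2k}}(a,b,c)\,Q_{\xi_{2k+1}}(a,b,c),$$ so that $F_\xi=0$ if some $\xi_i<0$. Let $\varepsilon_i$ be the $i$-th canonical basis vector of $\mathbb{Z}^\infty$, and for $i\ge1$ let $\delta_i\xi=\xi-\varepsilon_i-\varepsilon_{i+1}$ and $\delta_iF_\xi(a,b,c)=F_{\delta_i\xi}(a,b,c)$ (so $\delta_{i_1}\cdots\delta_{i_k}F_\xi=F_{\delta_{i_1}\cdots\delta_{i_k}\xi}$). Finally $$f_\lambda(a,b,c):=\sum_{k=0}^n(-abc)^k\sum_{1\le i_1<\cdots<i_k}\delta_{i_1}\cdots\delta_{i_k}F_{\Gamma(\lambda)}(a,b,c).$$ *)

(* Defs.v *)
From HB Require Import structures.
From mathcomp Require Import all_boot all_order all_algebra.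
From mathcomp Require Import boolp classical_sets functions cardinality fsbigop.
From mathcomp Require Import mpoly.

Set Implicit Arguments.
Unset Strict Implicit.
Unset Printing Implicit Defensive.

Import GRing.Theory.

Local Open Scope classical_set_scope.
Local Open Scope ring_scope.

Record mps (n : nat) (K : nzRingType) := MPS { mps_coef : 'X_{1..n} -> K }.

Section MPSRing.
Variables (n : nat) (K : comNzRingType).
Implicit Types (u v w : mps n K) (m : 'X_{1..n}).

HB.instance Definition _ := gen_eqMixin (mps n K).
HB.instance Definition _ := gen_choiceMixin (mps n K).

Lemma mpsP u v : mps_coef u =1 mps_coef v -> u = v.
Proof. by case: u v => [u] [v] /= /funext ->. Qed.

Definition mps0 : mps n K := MPS (fun=> 0).
Definition mps1 : mps n K := MPS (fun m => (m == 0%MM)%:R).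
Definition mps_opp u : mps n K := MPS (fun m => - mps_coef u m).
Definition mps_add u v : mps n K := MPS (fun m => mps_coef u m + mps_coef v m).
Definition mps_mul u v : mps n K :=
  MPS (fun m => \sum_(k : 'X_{1..n < (mdeg m).+1, (mdeg m).+1}
                       | m == (k.1 + k.2)%MM)
                  mps_coef u k.1 * mps_coef v k.2).

Let mps_addA : associative mps_add.
Proof. by move=> u v w; apply: mpsP => m /=; rewrite addrA. Qed.
Let mps_addC : commutative mps_add.
Proof. by move=> u v; apply: mpsP => m /=; rewrite addrC. Qed.
Let mps_add0 : left_id mps0 mps_add.
Proof. by move=> u; apply: mpsP => m /=; rewrite add0r. Qed.
Let mps_addN : left_inverse mps0 mps_opp mps_add.
Proof. by move=> u; apply: mpsP => m /=; rewrite addNr. Qed.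

HB.instance Definition _ :=
  GRing.isZmodule.Build (mps n K) mps_addA mps_addC mps_add0 mps_addN.

Definition mps_of_mpoly (p : {mpoly K[n]}) : mps n K := MPS (fun m => p@_m).

(* [u] agrees with the polynomial [p] in total degree less than [N]. *)
Definition mps_trunc_eq (N : nat) u (p : {mpoly K[n]}) :=
  forall m, (mdeg m < N)%N -> mps_coef u m = p@_m.

Lemma mps_trunc_ex (N : nat) u : {p | mps_trunc_eq N u p}.
Proof.
exists (\sum_(k : 'X_{1..n < N}) mps_coef u k *: 'X_[k]) => m ltm.
rewrite raddf_sum (bigD1 (BMultinom ltm)) //= mcoeffZ mcoeffX eqxx mulr1.
rewrite big1 ?addr0 // => k nek; rewrite mcoeffZ mcoeffX.
suff /negbTE -> : (k : 'X_{1..n}) != m by rewrite mulr0.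
by move: nek; rewrite bmeqP.
Qed.

Lemma mps_trunc_mul N u v p q :
  mps_trunc_eq N u p -> mps_trunc_eq N v q ->
  mps_trunc_eq N (mps_mul u v) (p * q).
Proof.
move=> up vq m ltm /=; rewrite mcoeffM; apply: eq_bigr => k _.
by rewrite up ?vq //; apply: leq_trans (bmdeg _) ltm.
Qed.

Lemma mps_truncP u v :
  (forall N, exists2 p, mps_trunc_eq N u p & mps_trunc_eq N v p) -> u = v.
Proof.
move=> uv; apply: mpsP => m; have [p up vp] := uv (mdeg m).+1.
by rewrite up ?vp.
Qed.

Let mps_mulA : associative mps_mul.
Proof.
move=> u v w; apply: mps_truncP => N.
have [[[p up] [q vq]] [r wr]] :=
  (mps_trunc_ex N u, mps_trunc_ex N v, mps_trunc_ex N w).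
exists (p * (q * r)); last rewrite mulrA.
- by apply: mps_trunc_mul => //; apply: mps_trunc_mul.
- by apply: mps_trunc_mul => //; apply: mps_trunc_mul.
Qed.

Let mps_mulC : commutative mps_mul.
Proof.
move=> u v; apply: mps_truncP => N.
have [[p up] [q vq]] := (mps_trunc_ex N u, mps_trunc_ex N v).
by exists (p * q); [|rewrite mulrC]; apply: mps_trunc_mul.
Qed.

Let mps_mul1 : left_id mps1 mps_mul.
Proof.
move=> u; apply: mps_truncP => N; have [p up] := mps_trunc_ex N u.
exists p => //; rewrite -[p]mul1r; apply: mps_trunc_mul => // m _ /=.
by rewrite mcoeff1.
Qed.

Let mps_mulDl : left_distributive mps_mul mps_add.
Proof.
move=> u v w; apply: mpsP => m /=; rewrite -big_split /=.
by apply: eq_bigr => k _; rewrite mulrDl.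
Qed.

Let mps1_neq0 : mps1 != mps0.
Proof.
apply/eqP => /(congr1 (fun u => mps_coef u 0%MM)) /= /eqP.
by rewrite eqxx oner_eq0.
Qed.

HB.instance Definition _ := GRing.Zmodule_isComNzRing.Build (mps n K)
  mps_mulA mps_mulC mps_mul1 mps_mulDl mps1_neq0.

Definition mps_unit : pred (mps n K) := fun u => `[< exists v, v * u = 1 >].
Definition mps_inv u : mps n K :=
  if u \in mps_unit then xget 0 [set v | v * u = 1] else u.

Let mps_mulVx : {in mps_unit, left_inverse 1 mps_inv *%R}.
Proof.
move=> u Uu; rewrite /mps_inv Uu; case: xgetP => [v _ //|novu].
by move: Uu; rewrite unfold_in => /asboolP[v vu]; case: (novu v).
Qed.

Let mps_unitPl u v : v * u = 1 -> u \in mps_unit.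
Proof. by move=> vu; rewrite unfold_in; apply/asboolP; exists v. Qed.

Let mps_inv_out : {in [predC mps_unit], mps_inv =1 id}.
Proof. by move=> u /negbTE Uu; rewrite /mps_inv Uu. Qed.

HB.instance Definition _ := GRing.ComNzRing_hasMulInverse.Build (mps n K)
  mps_mulVx mps_unitPl mps_inv_out.

Lemma mps_of_mpoly_is_zmod_morphism : zmod_morphism mps_of_mpoly.
Proof. by move=> p q; apply: mpsP => m /=; rewrite mcoeffB. Qed.

Lemma mps_of_mpoly_is_monoid_morphism : monoid_morphism mps_of_mpoly.
Proof.
split; first by apply: mpsP => m /=; rewrite mcoeff1.
by move=> p q; apply: mpsP => m /=; rewrite mcoeffM.
Qed.

HB.instance Definition _ := GRing.isZmodMorphism.Build {mpoly K[n]} (mps n K)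
  mps_of_mpoly mps_of_mpoly_is_zmod_morphism.
HB.instance Definition _ := GRing.isMonoidMorphism.Build {mpoly K[n]} (mps n K)
  mps_of_mpoly mps_of_mpoly_is_monoid_morphism.

Lemma mps_coefX_lt (u : mps n K) N m : mps_coef u 0%MM = 0 ->
  (mdeg m < N)%N -> mps_coef (u ^+ N) m = 0.
Proof.
move=> u0; elim: N m => // N IHN m ltmN; rewrite exprS.
apply: big1 => -[k1 k2] /= /eqP Em.
have [/eqP|k1_gt0] := posnP (mdeg k1).
  by rewrite mdeg_eq0 => /eqP->; rewrite u0 mul0r.
rewrite IHN ?mulr0 // -ltnS; apply: leq_trans ltmN.
have degm : mdeg m = (mdeg k1 + mdeg k2)%N by rewrite -mdegD -Em.
by rewrite ltnS [X in (_ < X)%N]degm -[X in (X < _)%N]add0n ltn_add2r.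
Qed.

Lemma mps_unitr (u : mps n K) : mps_coef u 0%MM = 1 -> u \is a GRing.unit.
Proof.
move=> u0; pose w := 1 - u.
have w0 : mps_coef w 0%MM = 0 by rewrite /= u0 eqxx subrr.
pose g N : mps n K := \sum_(k < N) w ^+ k.
pose v : mps n K := MPS (fun m => mps_coef (g (mdeg m).+1) m).
have coefD (s t : mps n K) m : mps_coef (s + t) m = mps_coef s m + mps_coef t m.
  by [].
have gE N m : (mdeg m < N)%N -> mps_coef (g N) m = mps_coef v m.
  move=> /subnKC <-; elim: (N - _)%N => [|d IHd]; first by rewrite addn0.
  rewrite addnS [g _]big_ord_recr coefD IHd [X in _ + X]mps_coefX_lt ?addr0 //.
  exact: leq_addr.
suff vu : v * u = 1 by apply/unitrP; exists v; split=> //; rewrite mulrC.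
apply: mpsP => m; have -> : mps_coef (v * u) m = mps_coef (g (mdeg m).+1 * u) m.
  by apply: eq_bigr => k _; rewrite gE ?bmdeg.
have -> : g (mdeg m).+1 * u = 1 - w ^+ (mdeg m).+1.
  rewrite -[X in X - w ^+ _](expr1n _ (mdeg m).+1) subrXX mulrC subKr.
  by congr (_ * _); apply: eq_bigr => k _; rewrite expr1n mul1r.
by rewrite coefD /= mps_coefX_lt // oppr0 addr0.
Qed.

End MPSRing.

Section MPSSum.
Variables (n : nat) (K : comNzRingType) (I : choiceType).
Implicit Types F : I -> mps n K.

Definition mps_summable F : Prop :=
  forall m, finite_set [set i | mps_coef (F i) m != 0].

(* Meaningful for summable families only. *)
Definition mps_sum F : mps n K :=
  MPS (fun m => \sum_(i \in [set: I]) mps_coef (F i) m).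

End MPSSum.

(* The quotient [p / q] of two elements of an integral domain, provided that
   [q != 0] and that [q] divides [p]. *)
Definition exquo (D : idomainType) (p q : D) : D :=
  xget 0 [set r | r * q = p].

Lemma exquoK (D : idomainType) (q r : D) : q != 0 -> exquo (r * q) q = r.
Proof.
move=> q0; rewrite /exquo; case: xgetP => [s _ /(mulIf q0) //|no].
by case: (no r).
Qed.

Definition lenpart (n : nat) : Type := {lam : n.-tuple nat | sorted geq lam}.
HB.instance Definition _ n := Choice.on (lenpart n).

(* The index [j] is zero-based: the exponent is that of [x_i] in the column
   of [lam_(j+1)], namely [lam_(j+1) + n - (j+1)]. *)
Definition alternant (n : nat) (K : comNzRingType) (lam : 'I_n -> nat) :
    {mpoly K[n]} :=
  \det (\matrix_(i < n, j < n) ('X_i ^+ (lam j + (n - j.+1)))).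

Definition schur (n : nat) (K : idomainType) (lam : n.-tuple nat) :
    {mpoly K[n]} :=
  exquo (alternant K (tnth lam)) (alternant K (fun=> 0%N)).

Section FLambda.
Variable R : idomainType.

Definition va : {mpoly R[3]} := 'X_(0 : 'I_3).
Definition vb : {mpoly R[3]} := 'X_(1 : 'I_3).
Definition vc : {mpoly R[3]} := 'X_(2 : 'I_3).

Local Notation a := va.
Local Notation b := vb.
Local Notation c := vc.

Definition hpol (r : int) : {mpoly R[3]} :=
  if r is Posz d then \sum_(m : 'X_{1..3 < d.+1} | mdeg m == d) 'X_[m] else 0.

Definition Ppol (r : int) : {mpoly R[3]} :=
  if r is Posz d then
    \sum_(k < d.+1) exquo (a ^+ k.+1 - b ^+ k.+1) (a - b)
                    * exquo (1 - (a * b) ^+ (d - k).+1) (1 - a * b) * c ^+ k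
  else 0.

Definition Qpol (r : int) : {mpoly R[3]} :=
  if r is Posz d then \sum_(k < d.+1) hpol (d%:Z - k%:Z) * (a * b * c) ^+ k
  else 0.

(* Sequences are zero-based: [xi i] is the term usually written [xi_(i+1)].
   When [xi] has finite support so does the product, as [Ppol 0 = Qpol 0 = 1]. *)
Definition Fpol (xi : nat -> int) : {mpoly R[3]} :=
  hpol (xi 0%N) *
  \big[*%R/1]_(k \in [set: nat]) (Ppol (xi k.*2.+1) * Qpol (xi k.*2.+2)).

Definition delta (i : nat) (xi : nat -> int) : nat -> int :=
  fun j => xi j - (j == i)%:R - (j == i.+1)%:R.

Definition Gamma (n : nat) (lam : n.-tuple nat) : nat -> int :=
  fun j => (nth 0%N lam j)%:Z - (nth 0%N lam j.+1)%:Z.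

(* The inner sum is over all strictly increasing [k]-tuples of indices. Only
   finitely many terms are nonzero: if the last index [i] of [s] is at least
   [n - 1], then the entry of index [i + 1] of the shifted sequence is [-1]. *)
Definition fpol (n : nat) (lam : n.-tuple nat) : {mpoly R[3]} :=
  \sum_(k < n.+1) (- (a * b * c)) ^+ k *
    \sum_(s \in [set s : k.-tuple nat | sorted ltn s])
       Fpol (foldr delta (Gamma lam) s).

End FLambda.

(* Main.v *)
Require Import Defs.
From HB Require Import structures.
From mathcomp Require Import all_boot all_order all_algebra.
From mathcomp Require Import boolp classical_sets functions cardinality fsbigop.
From mathcomp Require Import mpoly.
From mathcomp Require Import perm generic_quotient ring_quotient.
From mathcomp Require Import zify ring.

Set Implicit Arguments.
Unset Strict Implicit.
Unset Printing Implicit Defensive.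

Import GRing.Theory.

Local Open Scope ring_scope.

(** Multiplication by the Vandermonde determinant turns the Schur function of
    [lam] into the alternant of the strictly decreasing exponents
    [al j = lam j + (n - 1 - j)], so the theorem expands the Vandermonde
    determinant, divided by the product on the right, into alternants.

    Two rules on alternants carry the proof, and both come from subtracting
    from each column a multiple of a neighbouring one.  By the Pieri rule
    [pieri], an alternant over the product of the [1 - c x_i] is the sum of
    the alternants of [be], weighted by [c ^ (|be| - |al|)], where [be / al]
    is a horizontal strip: [be_0 >= al_0 > be_1 >= al_1 > ...].  By the
    branching rule [branching], an alternant in [m + 1] variables is the
    product of the [x_i - x_m] times a weighted sum, over the same interlacing
    condition, of alternants in [m] variables.

    The starting point is Littlewood's identity [littlewood_even]: the product
    of the [1 / (1 - x_j x_k)] is the sum of the Schur functions of the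
    partitions all of whose columns have even length.  It follows by induction
    on the number of variables: branching turns the indicator function of these
    partitions into the weight that the Pieri rule with [c = x_m] produces from
    it, which accounts for the new factors [1 - x_i x_m].  Three more
    applications of the Pieri rule, with [a], [b] and [c], give the product of
    the theorem.

    It remains to follow the coefficients.  At each step the coefficient of a
    partition with [c_j] columns of length [j] is a product of complete
    homogeneous polynomials [h_{c_j}(p_j, q_j)], where [(p_j, q_j)] depends on
    the parity of [j] only: [(0, 0)] and [(1, 0)] for odd and even [j] at the
    start, then [(a, 0)] and [(1, 0)], then [(a, b)] and [(1, ab)].  If
    [be / al] is a horizontal strip then the number of columns of length [j] of
    [al] is [u_j + t_{j+1}], where [t_j] is the number of columns of length [j]
    of [be] that lose their last box and [u_j] the number of the other ones.
    The identity [h_{u+t} = h_u h_t - p q h_{u-1} h_{t-1}] ([hpredD]) then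
    decouples the sum over the strips ([interlace_sum]).  The correction
    vanishes when [p q = 0], as in all the steps but the last one, where
    [p_j q_j = ab] for every [j]: choosing the correction at [j] produces the
    factor [- abc] and lowers both [c_j] and [c_{j+1}] by one.  This is the
    operator [delta], and the decoupled sums are [h], [P] and [Q]
    ([fpol_push_strip]).

    All of this takes place in a commutative ring in which the [x_i] are
    nilpotent, so that every sum is finite; it is applied to the polynomials
    modulo those that vanish up to a given degree.  The Vandermonde determinant
    is homogeneous, hence can be cancelled there at the expense of lowering
    that degree ([vanish_homog_div]). *)

(** * Complete homogeneous polynomials in two variables *)
Section TwoVariables.
Variable A : comNzRingType.
Implicit Types p q : A.

(** This is [h_{r-1}(p, q)]: with the degree shifted by one, the value at [0]
    is [h_{-1} = 0] and truncated subtraction on the degrees is harmless. *)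
Definition hpred p q r : A := \sum_(k < r) p ^+ k * q ^+ (r.-1 - k).

Lemma hpred0 p q : hpred p q 0 = 0.
Proof. exact: big_ord0. Qed.

Lemma hpredS p q r : hpred p q r.+1 = p ^+ r + q * hpred p q r.
Proof.
rewrite /hpred big_ord_recr /= subnn mulr1 addrC mulr_sumr; congr (_ + _).
apply: eq_bigr => k _; rewrite mulrCA -exprS; congr (_ * _ ^+ _).
by case: r k => [[]//|r] k /=; rewrite subSn // -ltnS.
Qed.

Lemma hpred1 p q : hpred p q 1 = 1.
Proof. by rewrite hpredS hpred0 mulr0 addr0. Qed.

Lemma hpredC p q r : hpred p q r = hpred q p r.
Proof.
rewrite /hpred (reindex_inj rev_ord_inj) /=; apply: eq_bigr => k _.
rewrite mulrC; congr (_ ^+ _ * _ ^+ _); have := ltn_ord k; lia.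
Qed.

Lemma hpredSS p q r :
  hpred p q r.+2 = (p + q) * hpred p q r.+1 - p * q * hpred p q r.
Proof.
by rewrite hpredS [in RHS]mulrDl [p * hpred _ _ r.+1]mulrC !hpredS exprS; ring.
Qed.

(** The addition formula of the recurrence [hpredSS], which lets a weight that
    depends on a sum of two numbers be expanded into weights that depend on
    each of them. *)
Lemma hpredD p q u t :
  hpred p q (u + t).+1 =
  hpred p q u.+1 * hpred p q t.+1 - p * q * (hpred p q u * hpred p q t).
Proof.
(* The recurrence has order two, hence the induction on two consecutive values. *)
suff [] : hpred p q (u + t).+1 =
            hpred p q u.+1 * hpred p q t.+1 - p * q * (hpred p q u * hpred p q t) /\
          hpred p q (u.+1 + t).+1 =
            hpred p q u.+2 * hpred p q t.+1 - p * q * (hpred p q u.+1 * hpred p q t)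
  by [].
elim: u => [|u [IH1 IH2]].
  by rewrite !add0n !addSn !add0n !hpredSS !hpred1 !hpred0; split; ring.
split=> //; rewrite !addSn hpredSS -addSn IH2 addSn IH1 [hpred p q u.+3]hpredSS.
by rewrite [in RHS](hpredSS p q u); rewrite [in LHS]hpredSS; ring.
Qed.

Lemma hpred_p0 p r : hpred p 0 r.+1 = p ^+ r.
Proof. by rewrite hpredS mul0r addr0. Qed.

Lemma hpred10 r : hpred 1 0 r.+1 = 1.
Proof. by rewrite hpred_p0 expr1n. Qed.

Lemma mul_subr_hpred p q r : (p - q) * hpred p q r = p ^+ r - q ^+ r.
Proof.
elim: r => [|r IHr]; first by rewrite hpred0 !expr0; ring.
by rewrite hpredS mulrDr mulrCA IHr !exprS; ring.
Qed.

End TwoVariables.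

(** * Strictly decreasing sequences and horizontal strips *)
Section Columns.
Variables (m N : nat).
Implicit Types al be : {ffun 'I_m -> 'I_N}.

(** The value [0] beyond the last index says that a sequence goes on with [-1];
    the last column length then needs no special treatment in [strict] and
    [gap]. *)
Definition succ_at al (k : nat) : nat :=
  if insub k is Some i then (al i).+1 else 0%N.

Lemma succ_atE al (i : 'I_m) : succ_at al i = (al i).+1.
Proof. by rewrite /succ_at valK. Qed.

Lemma succ_at_ge al k : (m <= k)%N -> succ_at al k = 0%N.
Proof. by move=> ?; rewrite /succ_at insubF // ltnNge; apply/negbF. Qed.

Lemma succ_at_ind al (P : nat -> Prop) (k : nat) :
  (forall i : 'I_m, k = i :> nat -> P (al i).+1) -> ((m <= k)%N -> P 0%N) ->
  P (succ_at al k).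
Proof.
move=> P1 P0; have [lemk|ltkm] := leqP m k; first by rewrite succ_at_ge //; apply: P0.
rewrite (succ_atE al (Ordinal ltkm)); exact: P1.
Qed.

Definition strict al := [forall j : 'I_m, succ_at al j.+1 <= al j]%N.

(** For [al j = lam j + (m - 1 - j)], the number of columns of length [j + 1]
    of the diagram of [lam]. *)
Definition gap al (j : 'I_m) : nat := (al j - succ_at al j.+1)%N.

(** For all [j] at once: the partition of [be] over that of [al] is a
    horizontal strip. *)
Definition strip_at al be (j : 'I_m) : bool :=
  (succ_at be j.+1 <= al j <= be j)%N.

Lemma strip_at_strict al be :
  [forall j, strip_at al be j] -> strict al && strict be.
Proof.
move=> /forallP win; apply/andP; split; apply/forallP => j; last first.
  by have /andP[] := win j; apply: leq_trans.
apply: (@leq_trans (succ_at be j.+1)); last by case/andP: (win j).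
apply: (succ_at_ind (al := al) (P := fun d => d <= succ_at be j.+1)%N) => // i ->.
by rewrite succ_atE ltnS; case/andP: (win i).
Qed.

(** For a set [S] of indices of operators [delta], each of which lowers the
    entries [i] and [i + 1]: the entry [j] is lowered once if [prev_in S j.+1]
    and once if [prev_in S j]. *)
Definition prev_in (S : {set 'I_m}) (k : nat) : bool :=
  [exists j in S, val j == k.-1] && (0 < k)%N.

Lemma prev_in0 S : prev_in S 0 = false.
Proof. by rewrite /prev_in andbF. Qed.

Lemma prev_inS S (j : 'I_m) : prev_in S j.+1 = (j \in S).
Proof.
rewrite /prev_in andbT /=; apply/exists_inP/idP => [[i iS /eqP /val_inj <-] //|jS].
by exists j.
Qed.

Variable A : comNzRingType.
Implicit Types p q : nat -> A.

(** The parameters are indexed by the length of the columns, from [1] on. *)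
Definition colweight p q al : A :=
  \prod_(j < m) hpred (p j.+1) (q j.+1) (gap al j).+1.

Lemma sum_interval_rev (G : nat -> nat -> A) (b : 'I_N) (d : nat) : (d <= b)%N ->
  \sum_(a : 'I_N) (if (d <= a <= b)%N then G (b - a)%N (a - d)%N else 0) =
  \sum_(t < (b - d).+1) G t (b - d - t)%N.
Proof.
move=> ledb; rewrite -big_mkcond /=.
rewrite (reindex_onto (fun t : 'I_(b - d).+1 => insubd b (b - t)%N)
                      (fun a : 'I_N => inord (b - a))) /=; last first.
  move=> a /andP[da ab]; apply: val_inj; rewrite /= inordK; last lia.
  by rewrite subKn // insubdK // unfold_in ltn_ord.
have insE (t : 'I_(b - d).+1) : insubd b (b - t)%N = (b - t)%N :> nat.
  by rewrite insubdK // unfold_in; have := ltn_ord b; lia.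
apply: eq_big => [t|t _]; rewrite insE; have := ltn_ord t => ltt.
  have -> : (d <= b - t <= b)%N by lia.
  by rewrite subKn ?inord_val ?eqxx //; lia.
by congr (G _ _); lia.
Qed.

(** In a strip, [gap al j] is the sum of [al j - be (j + 1) - 1] and of
    [be (j + 1) - al (j + 1)], and [gap be j] is the sum of the former number
    and of [be j - al j].  By [hpredD] each factor of the weight is
    a sum of two products of functions of one of these numbers; [S] is the set
    of the factors for which the second product is chosen, and once it is chosen
    every [al j] ranges over its own interval.  The values [p 0 = 1], [q 0 = 0]
    make the factor for the columns of length [0] equal to one. *)
Lemma interlace_sum p q (om : 'I_m -> nat -> A) be :
  strict be -> p 0%N = 1 -> q 0%N = 0 ->
  \sum_(al : {ffun 'I_m -> 'I_N})
    (\prod_j (if strip_at al be j then om j (be j - al j)%N else 0)) *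
    colweight p q al
  = \sum_(S : {set 'I_m}) (~~ prev_in S m)%:R *
    \prod_(j < m) ((- (p j.+1 * q j.+1)) ^+ prev_in S j.+1 *
       \sum_(t < (gap be j).+1) om j t *
          hpred (p j.+1) (q j.+1) ((gap be j - t).+1 - prev_in S j.+1) *
          hpred (p j) (q j) (t.+1 - prev_in S j)).
Proof.
move=> /forallP sbe p0 q0; rewrite /strip_at.
pose T S j (a : 'I_N) : A :=
  if (succ_at be (j : 'I_m).+1 <= a <= be j)%N then
    (- (p j.+1 * q j.+1)) ^+ prev_in S j.+1 * (om j (be j - a)%N *
     hpred (p j.+1) (q j.+1) ((a - succ_at be j.+1).+1 - prev_in S j.+1) *
     hpred (p j) (q j) ((be j - a).+1 - prev_in S j)) else 0.
transitivity (\sum_(al : {ffun 'I_m -> 'I_N}) \sum_(S : {set 'I_m})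
                (~~ prev_in S m)%:R * \prod_j T S j (al j)); last first.
  rewrite exchange_big; apply: eq_bigr => S _; rewrite -mulr_sumr.
  congr (_ * _); rewrite -(bigA_distr_bigA (fun j a => T S j a)).
  apply: eq_bigr => j _; rewrite mulr_sumr.
  exact: (sum_interval_rev (fun t u => (- (p j.+1 * q j.+1)) ^+ prev_in S j.+1 *
     (om j t * hpred (p j.+1) (q j.+1) (u.+1 - prev_in S j.+1) *
     hpred (p j) (q j) (t.+1 - prev_in S j)))).
apply: eq_bigr => al _.
have [/forallP win|] :=
  boolP [forall j : 'I_m, succ_at be j.+1 <= al j <= be j]%N; last first.
  case/forallPn => j nwin; rewrite (bigD1 j) //= (negPf nwin) !mul0r.
  by rewrite big1 // => S _; rewrite (bigD1 j) //= /T (negPf nwin) mul0r mulr0.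
have succ_at_le k : (succ_at al k <= succ_at be k)%N.
  apply: (succ_at_ind (al := al) (P := fun d => d <= succ_at be k)%N) => // i ->.
  by rewrite succ_atE ltnS; case/andP: (win i).
pose G S k := hpred (p k) (q k) ((succ_at be k - succ_at al k).+1 - prev_in S k).
have wE : colweight p q al = \sum_(S : {set 'I_m}) \prod_(j < m)
  ((- (p j.+1 * q j.+1)) ^+ prev_in S j.+1 *
   hpred (p j.+1) (q j.+1) ((al j - succ_at be j.+1).+1 - prev_in S j.+1) * G S j.+1).
  rewrite /colweight; under eq_bigr => j _.
    have -> : gap al j = ((al j - succ_at be j.+1) +
                          (succ_at be j.+1 - succ_at al j.+1))%N.
      by rewrite /gap addnBA ?succ_at_le // subnK //; case/andP: (win j).
    rewrite hpredD addrC -mulNr; over.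
  rewrite bigA_distr /=; apply: eq_bigr => S _; apply: eq_bigr => j _.
  rewrite /G !prev_inS; case: (j \in S).
    by rewrite !subn1 expr1 mulrA.
  by rewrite !subn0 expr0 mul1r.
rewrite wE mulr_sumr; apply: eq_bigr => S _.
(* Each second factor is handed over to the next index; the one at the end of
   the sequence vanishes exactly when the last index is in [S]. *)
have GE : \prod_(j < m) G S j.+1 = (~~ prev_in S m)%:R * \prod_(j < m) G S j.
  transitivity (\prod_(k < m.+1) G S k).
    by rewrite big_ord_recl {2}/G /= p0 q0 prev_in0 subn0 hpred10 mul1r.
  rewrite big_ord_recr mulrC /=; congr (_ * _).
  rewrite /G !succ_at_ge // subnn.
  by case: (prev_in S m); rewrite ?subn0 ?hpred1 // subnn hpred0.
rewrite big_split /= GE [X in _ * X]mulrCA [LHS]mulrCA; congr (_ * _).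
rewrite -!big_split /=; apply: eq_bigr => j _.
rewrite /T win /G !succ_atE subSS; ring.
Qed.

End Columns.

(** * The Pieri and branching rules for alternants *)
Lemma prod_if (A : comNzRingType) (I : finType) (P : pred I) (F : I -> A) :
  \prod_i (if P i then F i else 0) = if [forall i, P i] then \prod_i F i else 0.
Proof.
case: ifP => [/forallP allP|/negbT/forallPn[i nPi]].
  by apply: eq_bigr => i _; rewrite allP.
by rewrite (bigD1 i) //= (negPf nPi) mul0r.
Qed.

Lemma sum_interval (A : comNzRingType) N (G : nat -> A) lo hi : (hi <= N)%N ->
  \sum_(b < N) (if (lo <= b < hi)%N then G b else 0) =
  \sum_(t < hi - lo) G (lo + t)%N.
Proof.
move=> lehN; rewrite -big_mkcond /=.
rewrite -(big_mkord (fun b => lo <= b < hi)%N G).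
rewrite -[RHS](big_mkord xpredT (fun t => G (lo + t)%N)).
under [RHS]eq_bigr do rewrite addnC.
rewrite -[RHS](big_addn 0 hi lo xpredT G) add0n (big_nat_widenl lo 0%N) //.
by rewrite (big_nat_widen _ hi N).
Qed.

Lemma det_unitrig (A : comNzRingType) m (U : 'M[A]_m) :
  is_trig_mx U -> (forall i, U i i = 1) -> \det U = 1.
Proof. by move=> trigU U1; rewrite det_trig // big1. Qed.

Section Determinants.
Variables (A : comNzRingType) (x : nat -> A).

Definition altdet m N (al : {ffun 'I_m -> 'I_N}) : A :=
  \det (\matrix_(i < m, j < m) x i ^+ al j).

Lemma det_sum_columns m N (w : 'I_m -> 'I_N -> A) :
  \det (\matrix_(i < m, j < m) \sum_(b < N) w j b * x i ^+ b) =
  \sum_(be : {ffun 'I_m -> 'I_N}) (\prod_j w j (be j)) * altdet be.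
Proof.
rewrite -det_tr; under [RHS]eq_bigr do rewrite /altdet -det_tr mulr_sumr.
rewrite exchange_big; apply: eq_bigr => s _ /=.
under eq_bigr do rewrite !mxE.
rewrite bigA_distr_bigA mulr_sumr; apply: eq_bigr => be _ /=.
by rewrite mulrCA -big_split; congr (_ * _); apply: eq_bigr => i _; rewrite !mxE.
Qed.

(** Subtract from each column [x ^ al_j] the column [x ^ al_{j-1}] times
    [c ^ (al_{j-1} - al_j)]: every entry becomes divisible by [1 - c x], with the
    quotient the sum of the [c ^ (b - al_j) x ^ b] for [al_j <= b < al_{j-1}].
    In column [0] the bound [al_{-1}] is [N], because [x ^ N = 0]. *)
Lemma pieri m N (c : A) (al : {ffun 'I_m -> 'I_N}) :
  (forall i, x i ^+ N = 0) -> strict al ->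
  altdet al = \prod_(i < m) (1 - c * x i) *
    \sum_(be : {ffun 'I_m -> 'I_N})
      (\prod_j (if strip_at al be j then c ^+ (be j - al j) else 0)) * altdet be.
Proof.
move=> xN /forallP sal.
(* The exponent of the preceding column, with [N] before the first one. *)
pose up (j : 'I_m) : nat := if val j is j'.+1 then (succ_at al j').-1 else N.
have upE (k j : 'I_m) : val j = k.+1 -> up j = al k.
  by rewrite /up => ->; rewrite succ_atE.
have leup j : (al j <= up j <= N)%N.
  rewrite /up; case: j => [[|j'] ltj] /=; first by rewrite ltnW //=.
  have := sal (Ordinal (ltnW ltj)); rewrite /= -[j'.+1]/(val (Ordinal ltj)) succ_atE.
  rewrite (succ_atE al (Ordinal (ltnW ltj))) /= => /ltnW ->.
  by rewrite ltnW.
pose w (j : 'I_m) (b : 'I_N) :=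
  if (al j <= b < up j)%N then c ^+ (b - al j) else 0.
transitivity (\prod_(i < m) (1 - c * x i) *
              \sum_(be : {ffun 'I_m -> 'I_N}) (\prod_j w j (be j)) * altdet be);
  last first.
  congr (_ * _); apply: eq_bigr => be _; congr (_ * _).
  rewrite !prod_if; congr (if _ then _ else _).
  apply/forallP/forallP => H j.
    rewrite /strip_at; have /andP[-> _] : (al j <= be j < up j)%N := H j; rewrite andbT.
    apply: (succ_at_ind (al := be) (P := fun d => d <= al j)%N) => // i ei.
    by have /andP[_] := H i; rewrite (upE j).
  have /andP[_ -> /=] := H j; case: j => [[|j'] ltj]; first exact: ltn_ord.
  rewrite (upE (Ordinal (ltnW ltj))) //.
  have /andP[+ _] := H (Ordinal (ltnW ltj)).
  by rewrite /= (succ_atE be (Ordinal ltj)).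
rewrite -det_sum_columns.
pose U : 'M[A]_m := \matrix_(k, j)
  ((k == j)%:R - (if k.+1 == j :> nat then c ^+ (al k - al j) else 0)).
have detU : \det U = 1.
  rewrite -det_tr; apply: det_unitrig => [|i]; last first.
    by rewrite !mxE eqxx (_ : _ == _ = false) ?subr0 //; lia.
  apply/is_trig_mxP => i j ltij; rewrite !mxE.
  rewrite (_ : j == i = false); last by apply/eqP => e; rewrite e ltnn in ltij.
  by rewrite (_ : j.+1 == i :> nat = false) ?subr0 //; lia.
rewrite -[LHS]mulr1 -{1}detU -det_mulmx.
have -> : \prod_(i < m) (1 - c * x i) =
          \det (diag_mx (\row_(i < m) (1 - c * x i))).
  by rewrite det_diag; apply: eq_bigr => i _; rewrite mxE.
rewrite -det_mulmx; congr (\det _); apply/matrixP => i j.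
rewrite mul_diag_mx !mxE.
under [in RHS]eq_bigr => b _ do rewrite /w (fun_if (fun z => z * _)) mul0r.
have /andP[leau leuN] := leup j.
rewrite (sum_interval (fun b => c ^+ (b - al j) * x i ^+ b)) //.
have -> : \sum_(t < up j - al j) c ^+ (al j + t - al j) * x i ^+ (al j + t) =
          x i ^+ al j * hpred (c * x i) 1 (up j - al j).
  rewrite /hpred mulr_sumr; apply: eq_bigr => t _.
  by rewrite addKn exprD expr1n exprMn; ring.
rewrite mulrCA [hpred _ _ _]hpredC mul_subr_hpred expr1n exprMn mulrBr mulr1.
rewrite mulrCA -exprD subnKC //.
under eq_bigr => k _ do rewrite !mxE mulrBr.
rewrite big_split /= (bigD1 j) //= eqxx mulr1 big1 ?addr0; last first.
  by move=> k /negPf ->; rewrite mulr0.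
congr (_ + _); rewrite sumrN; congr (- _).
case: j leau leuN => [[|j'] ltj] leau leuN.
  by rewrite big1 ?xN ?mulr0 //= => k _; rewrite mulr0.
pose k0 := Ordinal (ltnW ltj); rewrite (upE k0) // (bigD1 k0) //= eqxx big1 ?addr0.
  by rewrite mulrC.
move=> k nk; rewrite (_ : k.+1 == j'.+1 = false) ?mulr0 //.
by apply: contraNF nk => /eqP[e]; apply/eqP/val_inj.
Qed.

(** Subtract from each column but the last the next one times the power of
    [x_m] that kills the entry in row [m].  The other entries of the column are
    then divisible by [x_i - x_m], and the quotients are sums of consecutive
    powers of [x_i], so that [be] interlaces with [al]. *)
Lemma branching m N (al : {ffun 'I_m.+1 -> 'I_N.+1}) : strict al ->
  altdet al = \prod_(i < m) (x i - x m) *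
    \sum_(be : {ffun 'I_m -> 'I_N})
      (x m ^+ al ord_max *
       \prod_(j < m) (if (succ_at al j.+1 <= (be j).+1 <= al (widen_ord (leqnSn m) j))%N
                      then x m ^+ (al (widen_ord (leqnSn m) j) - (be j).+1) else 0))
      * altdet be.
Proof.
move=> /forallP sal; set y := x m.
pose lo (j : nat) : nat := (succ_at al j.+1).-1.
pose wi := widen_ord (leqnSn m).
have loE (j k : 'I_m.+1) : val k = j.+1 -> lo j = al k.
  by rewrite /lo => <-; rewrite succ_atE.
have succ_at_lo (j : 'I_m) : succ_at al j.+1 = (lo j).+1.
  rewrite (loE (wi j) (lift ord0 j)) //.
  by rewrite -[j.+1]/(val (lift ord0 j)) succ_atE.
have lelo (j : 'I_m) : (lo j < al (wi j))%N.
  by rewrite -succ_at_lo; apply: (sal (wi j)).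
pose w (j : 'I_m) (b : 'I_N) :=
  if (lo j <= b < al (wi j))%N then y ^+ ((al (wi j)).-1 - b) else 0.
transitivity (\prod_(i < m) (x i - y) *
   (y ^+ al ord_max *
    \sum_(be : {ffun 'I_m -> 'I_N}) (\prod_j w j (be j)) * altdet be)); last first.
  congr (_ * _); rewrite mulr_sumr; apply: eq_bigr => be _.
  rewrite mulrA; congr (_ * _ * _); apply: eq_bigr => j _.
  rewrite /w succ_at_lo ltnS; case: ifP => // _; congr (_ ^+ _).
  by rewrite -subn1 -subnDA.
rewrite -det_sum_columns.
pose U : 'M[A]_m.+1 := \matrix_(k, j)
  ((k == j)%:R - (if k == j.+1 :> nat then y ^+ (al j - al k) else 0)).
have detU : \det U = 1.
  apply: det_unitrig => [|i]; last first.
    by rewrite !mxE eqxx (_ : _ == _ = false) ?subr0 //; lia.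
  apply/is_trig_mxP => i j ltij; rewrite !mxE.
  rewrite (_ : i == j = false); last by apply/eqP => e; rewrite e ltnn in ltij.
  by rewrite (_ : i == j.+1 :> nat = false) ?subr0 //; lia.
rewrite -[LHS]mulr1 -{1}detU -det_mulmx.
set M := _ *m U.
have ME (i j : 'I_m.+1) :
  M i j = x i ^+ al j - (if (j < m)%N then y ^+ (al j - lo j) * x i ^+ lo j else 0).
  rewrite !mxE; under eq_bigr => k _ do rewrite !mxE mulrBr.
  rewrite big_split /= (bigD1 j) //= eqxx mulr1 big1 ?addr0; last first.
    by move=> k /negPf ->; rewrite mulr0.
  congr (_ + _); rewrite sumrN; congr (- _).
  have [ltjm|lemj] := ltnP j m; last first.
    rewrite big1 // => k _; rewrite (_ : _ == _ = false) ?mulr0 //.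
    by have := ltn_ord k; lia.
  pose k0 : 'I_m.+1 := Ordinal (ltjm : j.+1 < m.+1)%N.
  rewrite (loE j k0) // (bigD1 k0) //= eqxx big1 ?addr0; first by rewrite mulrC.
  move=> k nk; rewrite (_ : k == j.+1 :> nat = false) ?mulr0 //.
  by apply: contraNF nk => /eqP e; apply/eqP/val_inj.
have lastE (j : 'I_m) : M ord_max (wi j) = 0.
  by rewrite ME /= ltn_ord -/y -exprD subnK ?subrr // ltnW.
rewrite (expand_det_row _ ord_max) (bigD1 ord_max) //= big1 ?addr0; last first.
  move=> j nj; have ltj : (j < m)%N.
    by have := ltn_ord j; move: nj; rewrite -val_eqE /=; lia.
  by rewrite (_ : j = wi (Ordinal ltj)) ?lastE ?mul0r //; apply: val_inj.
rewrite ME ltnn subr0 -/y /cofactor /= addnn -signr_odd odd_double mul1r mulrCA.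
congr (_ * _).
have -> : \prod_(i < m) (x i - y) =
          \det (diag_mx (\row_(i < m) (x i - y))).
  by rewrite det_diag; apply: eq_bigr => i _; rewrite mxE.
rewrite -det_mulmx; congr (\det _); apply/matrixP => i j.
have liftE (k : 'I_m) : lift ord_max k = wi k by apply: val_inj; exact: lift_max.
rewrite mul_diag_mx [LHS]mxE [in LHS]mxE !liftE ME /= ltn_ord !mxE.
under [in RHS]eq_bigr => b _ do rewrite /w (fun_if (fun z => z * _)) mul0r.
have lealN : (al (wi j) <= N)%N by rewrite -ltnS ltn_ord.
rewrite (sum_interval (fun b => y ^+ ((al (wi j)).-1 - b) * x i ^+ b)) //.
have -> : \sum_(t < al (wi j) - lo j)
            y ^+ ((al (wi j)).-1 - (lo j + t)) * x i ^+ (lo j + t) =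
          x i ^+ lo j * hpred (x i) y (al (wi j) - lo j).
  rewrite /hpred mulr_sumr; apply: eq_bigr => t _.
  rewrite exprD (_ : ((al (wi j)).-1 - (lo j + t) = (al (wi j) - lo j).-1 - t)%N).
    by ring.
  by lia.
rewrite mulrCA mul_subr_hpred mulrBr -exprD subnKC; last exact: ltnW.
by congr (_ - _); rewrite mulrC.
Qed.

End Determinants.

(** * Coefficients along horizontal strips *)
Section Push.
Variables (A : comNzRingType) (m N : nat).
Implicit Types (al be : {ffun 'I_m -> 'I_N}) (p q : nat -> A).

(** When all the products [p q] vanish, only the empty set [S] contributes. *)
Lemma interlace_sum0 p q (om : 'I_m -> nat -> A) be :
  strict be -> p 0%N = 1 -> q 0%N = 0 ->
  (forall k, (0 < k)%N -> p k * q k = 0) ->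
  \sum_(al : {ffun 'I_m -> 'I_N})
     (\prod_j (if strip_at al be j then om j (be j - al j)%N else 0)) *
     colweight p q al
  = \prod_(j < m) \sum_(t < (gap be j).+1) om j t *
       hpred (p j.+1) (q j.+1) (gap be j - t).+1 * hpred (p j) (q j) t.+1.
Proof.
move=> sbe p0 q0 pq0; rewrite interlace_sum // (bigD1 finset.set0) //=.
rewrite [X in _ + X]big1 ?addr0.
  have in0 k : prev_in (finset.set0 : {set 'I_m}) k = false.
    rewrite /prev_in andbC; case: k => //= k.
    by apply/exists_inP => -[i]; rewrite inE.
  rewrite in0 /= mul1r; apply: eq_bigr => j _; rewrite !in0 expr0 mul1r.
  by apply: eq_bigr => t _; rewrite !subn0.
move=> S /finset.set0Pn[j jS].
by rewrite (bigD1 j) //= prev_inS jS pq0 // oppr0 !mul0r mulr0.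
Qed.

(** The coefficient of [be] in the product of the sum of the [g al] times the
    Schur function of [al] with the series of the complete homogeneous
    functions in [c x_0, c x_1, ...]. *)
Definition push_strip (c : A) (g : {ffun 'I_m -> 'I_N} -> A) be : A :=
  \sum_(al : {ffun 'I_m -> 'I_N})
    (\prod_j (if strip_at al be j then c ^+ (be j - al j) else 0)) * g al.

(** The coefficient of degree [r - 1] in the product of the series of the
    [h_t(p_j, q_j) c ^ t] and of the [h_t(p_{j+1}, q_{j+1})]; at [r = 0] this
    is [0], as required of an entry [-1]. *)
Definition strip_conv (c : A) p q (j r : nat) : A :=
  \sum_(t < r) c ^+ t * hpred (p j.+1) (q j.+1) (r - t) * hpred (p j) (q j) t.+1.

Lemma strip_conv_shift c p q j r (s s' : bool) :
  \sum_(t < r.+1) c ^+ t * hpred (p j.+1) (q j.+1) ((r - t).+1 - s) *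
     hpred (p j) (q j) (t.+1 - s') = c ^+ s' * strip_conv c p q j (r.+1 - s - s').
Proof.
rewrite /strip_conv.
case: s s' => [] []; rewrite /= ?expr0 ?expr1 ?mul1r ?subn0 ?subn1 /=.
- case: r => [|r].
    by rewrite big_ord1 big_ord0 !subn1 /= subnn !hpred0 !mulr0.
  rewrite big_ord_recl big_ord_recr /= subn1 hpred0 mulr0 add0r.
  rewrite subnn subn1 hpred0 mulr0 mul0r addr0 mulr_sumr.
  apply: eq_bigr => t _.
  by rewrite /bump /= add1n !subn1 subSS /= exprS !mulrA.
- rewrite big_ord_recr /= subnn subn1 hpred0 mulr0 mul0r addr0.
  by apply: eq_bigr => t _; rewrite subn1 subn0.
- rewrite big_ord_recl /= subn1 hpred0 mulr0 add0r mulr_sumr.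
  by apply: eq_bigr => t _; rewrite /bump /= add1n subn1 subn0 exprS !mulrA subnSK.
- by apply: eq_bigr => t _; rewrite !subn0 subSn // -ltnS.
Qed.

(** Each index in [S] contributes one [- p q] from [interlace_sum] and one [c],
    from the shift of the number of columns that lose a box. *)
Lemma push_strip_weight c p q be : strict be -> p 0%N = 1 -> q 0%N = 0 ->
  push_strip c (colweight p q) be =
  \sum_(S : {set 'I_m}) (~~ prev_in S m)%:R *
    \prod_(j < m) ((- (c * (p j.+1 * q j.+1))) ^+ prev_in S j.+1 *
       strip_conv c p q j ((gap be j).+1 - prev_in S j.+1 - prev_in S j)).
Proof.
move=> sbe p0 q0; rewrite /push_strip (interlace_sum (fun=> fun t => c ^+ t)) //.
apply: eq_bigr => S _.
have [Sm|nSm] := boolP (prev_in S m); first by rewrite !mul0r.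
rewrite !mul1r; under eq_bigr do rewrite strip_conv_shift mulrCA.
rewrite big_split /=.
have -> : \prod_(j < m) c ^+ prev_in S j = \prod_(j < m) c ^+ prev_in S j.+1.
  transitivity (\prod_(j < m.+1) c ^+ prev_in S j).
    by rewrite big_ord_recr /= (negPf nSm) mulr1.
  by rewrite big_ord_recl /= prev_in0 mul1r.
rewrite -big_split; apply: eq_bigr => j _ /=.
by rewrite mulrA -exprMn mulrN.
Qed.

(** With [q = 0] the weights [h_r(p, 0)] are powers, and the convolution of two
    sequences of powers is again a complete homogeneous polynomial. *)
Lemma push_strip_weight0 c p be : strict be -> p 0%N = 1 ->
  push_strip c (colweight p (fun=> 0)) be =
  \prod_(j < m) hpred (c * p j) (p j.+1) (gap be j).+1.
Proof.
move=> sbe p0; rewrite /push_strip (interlace_sum0 (fun=> fun t => c ^+ t)) //;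
  last first.
  by move=> k _; rewrite mulr0.
apply: eq_bigr => j _; apply: eq_bigr => t _ /=.
by rewrite !hpred_p0 exprMn; ring.
Qed.

End Push.

(** * Littlewood's identity and its three-parameter extension *)
Section Stages.
Variables (A : comNzRingType) (x : nat -> A).

Definition altsum m N (g : {ffun 'I_m -> 'I_N} -> A) : A :=
  \sum_(al : {ffun 'I_m -> 'I_N} | strict al) g al * altdet x al.

Lemma eq_altsum m N (g h : {ffun 'I_m -> 'I_N} -> A) :
  (forall al, strict al -> g al = h al) -> altsum g = altsum h.
Proof. by move=> gh; apply: eq_bigr => al /gh ->. Qed.

Lemma altsum_push_strip m N c (g : {ffun 'I_m -> 'I_N} -> A) :
  (forall i, x i ^+ N = 0) ->
  altsum g = \prod_(i < m) (1 - c * x i) * altsum (push_strip c g).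
Proof.
move=> xN; rewrite /altsum.
under eq_bigr => al sal do rewrite (pieri c) // mulrCA mulr_sumr.
rewrite -mulr_sumr; congr (_ * _).
under [RHS]eq_bigr do rewrite mulr_suml.
rewrite exchange_big big_mkcond [RHS]big_mkcond /=; apply: eq_bigr => be _.
rewrite big_mkcond; case: ifP => sbe; last first.
  rewrite big1 // => al _; case: ifP => // _; rewrite prod_if.
  by case: ifP => [/strip_at_strict|]; rewrite ?sbe ?andbF // mul0r mulr0.
apply: eq_bigr => al _; case: ifP => sal; first by ring.
by rewrite prod_if; case: ifP => [/strip_at_strict|]; rewrite ?sal // !mul0r.
Qed.

(** At [k = 0], [colp] and [colq] are the values [1] and [0] required by
    [interlace_sum]; at odd [k] they are [a] and [b], and at even [k] they are
    [1] and [ab]. *)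
Definition colp (a : A) (k : nat) : A := if odd k then a else 1.

Definition colq (a b : A) (k : nat) : A :=
  if k is 0%N then 0 else if odd k then b else a * b.

(** The sequence with a new largest entry [N].  Then [be] arises from [al] by
    branching exactly when [prepend be] over [al] is a horizontal strip, and
    the sums over [al] of both rules become instances of [interlace_sum]. *)
Definition prepend m N (be : {ffun 'I_m -> 'I_N}) : {ffun 'I_m.+1 -> 'I_N.+1} :=
  [ffun j => if unlift ord0 j is Some i then widen_ord (leqnSn N) (be i)
             else ord_max].

Lemma prepend0 m N (be : {ffun 'I_m -> 'I_N}) : prepend be ord0 = ord_max.
Proof. by rewrite ffunE unlift_none. Qed.

Lemma prependS m N (be : {ffun 'I_m -> 'I_N}) i :
  prepend be (lift ord0 i) = be i :> nat.
Proof. by rewrite ffunE liftK. Qed.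

Lemma succ_at_prepend m N (be : {ffun 'I_m -> 'I_N}) k :
  succ_at (prepend be) k.+1 = succ_at be k.
Proof.
have [lemk|ltkm] := leqP m k; first by rewrite !succ_at_ge.
rewrite (succ_atE be (Ordinal ltkm)).
rewrite (succ_atE (prepend be) (lift ord0 (Ordinal ltkm))).
by rewrite prependS.
Qed.

Lemma strict_prepend m N (be : {ffun 'I_m -> 'I_N}) : strict (prepend be) = strict be.
Proof.
apply/forallP/forallP => sbe j.
  by have := sbe (lift ord0 j); rewrite prependS succ_at_prepend lift0.
case: (unliftP ord0 j) => [i|] ->; first by rewrite prependS succ_at_prepend lift0.
rewrite prepend0 succ_at_prepend.
by apply: (succ_at_ind (al := be) (P := fun d => d <= N)%N).
Qed.

Lemma branching_kernel m N (y : A) (al : {ffun 'I_m.+1 -> 'I_N.+1})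
    (be : {ffun 'I_m -> 'I_N}) :
  y ^+ al ord_max *
    \prod_(j < m) (if (succ_at al j.+1 <= (be j).+1 <= al (widen_ord (leqnSn m) j))%N
                   then y ^+ (al (widen_ord (leqnSn m) j) - (be j).+1) else 0) =
  \prod_j (if strip_at al (prepend be) j
           then y ^+ (gap (prepend be) j - (prepend be j - al j)) else 0).
Proof.
set wi := widen_ord _; rewrite !prod_if.
have succ_atb (j : 'I_m) : succ_at (prepend be) j.+1 = (be j).+1.
  by rewrite succ_at_prepend succ_atE.
have winE : [forall j, strip_at al (prepend be) j] =
    [forall j : 'I_m, (succ_at al j.+1 <= (be j).+1 <= al (wi j))%N].
  apply/forallP/forallP => win j.
    have /andP[_] := win (lift ord0 j); have /andP[+ _] := win (wi j).
    rewrite succ_atb prependS => -> /=; rewrite andbT -lift0 succ_atE ltnS; exact.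
  apply/andP; split.
    have [ltjm|lemj] := ltnP j m; last by rewrite succ_at_ge.
    have /andP[_] := win (Ordinal ltjm); rewrite -succ_atb /=.
    by congr (_ <= nat_of_ord (al _))%N; apply: val_inj.
  case: (unliftP ord0 j) => [i|] ->; last by rewrite prepend0 -ltnS ltn_ord.
  have /andP[+ _] := win i; rewrite prependS -lift0 succ_atE ltnS; exact.
rewrite -winE; case: ifPn => [/forallP win|_]; last by rewrite mulr0.
have gapE (j : 'I_m.+1) :
    (gap (prepend be) j - (prepend be j - al j) = al j - succ_at (prepend be) j.+1)%N.
  by have /andP[? ?] := win j; rewrite /gap; lia.
rewrite [RHS]big_ord_recr mulrC /= gapE succ_at_ge // subn0; congr (_ * _).
by apply: eq_bigr => j _; rewrite gapE succ_atb.
Qed.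

(** The value [p 1 = 0] forces [al] to have no column of length [1], hence
    [al 0 = al 1 + 1]; this is why the result does not depend on [N]. *)
Lemma altsum_branching m N p :
  p 0%N = 1 -> p 1%N = 0 ->
  altsum (colweight p (fun=> 0) : {ffun 'I_m.+1 -> 'I_N.+1} -> A) =
  \prod_(i < m) (x i - x m) *
  altsum (fun be : {ffun 'I_m -> 'I_N} =>
            \prod_(j < m) hpred (p j.+1) (x m * p j.+2) (gap be j).+1).
Proof.
move=> p0 p1; rewrite /altsum.
under eq_bigr => al sal do rewrite branching // mulrCA mulr_sumr.
rewrite -mulr_sumr; congr (_ * _); rewrite exchange_big [RHS]big_mkcond /=.
apply: eq_bigr => be _; set K := BIG_F.
transitivity ((\sum_(al : {ffun 'I_m.+1 -> 'I_N.+1})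
   (\prod_j (if strip_at al (prepend be) j
       then x m ^+ (gap (prepend be) j - (prepend be j - al j)) else 0)) *
     colweight p (fun=> 0) al) * altdet x be).
  rewrite mulr_suml big_mkcond /=; apply: eq_bigr => al _; rewrite /K branching_kernel.
  case: ifP => sal; first by rewrite mulrCA mulrA.
  by rewrite prod_if; case: ifP => [/strip_at_strict|]; rewrite ?sal // !mul0r.
case: ifP => sbe; last first.
  rewrite big1 ?mul0r // => al _; rewrite prod_if.
  by case: ifP => [/strip_at_strict|]; rewrite ?strict_prepend ?sbe ?andbF // mul0r.
congr (_ * _).
rewrite (interlace_sum0 (fun j t => x m ^+ (gap (prepend be) j - t)))
  ?strict_prepend //; last first.
  by move=> k _; rewrite mulr0.
have sumE (j : 'I_m.+1) :
    \sum_(t < (gap (prepend be) j).+1) x m ^+ (gap (prepend be) j - t) *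
       hpred (p j.+1) 0 (gap (prepend be) j - t).+1 * hpred (p j) 0 t.+1 =
    hpred (p j) (x m * p j.+1) (gap (prepend be) j).+1.
  by apply: eq_bigr => t _ /=; rewrite !hpred_p0 exprMn mulrC.
rewrite (eq_bigr _ (fun j _ => sumE j)).
rewrite big_ord_recl p0 p1 mulr0 hpred10 mul1r; apply: eq_bigr => j _.
by rewrite !lift0 /gap prependS succ_at_prepend.
Qed.

Lemma altsum_stage m N c p p' q' : (forall i, x i ^+ N = 0) -> p 0%N = 1 ->
  (forall j r, hpred (c * p j) (p j.+1) r = hpred (p' j.+1) (q' j.+1) r) ->
  altsum (colweight p (fun=> 0) : {ffun 'I_m -> 'I_N} -> A) =
  \prod_(i < m) (1 - c * x i) *
  altsum (colweight p' q' : {ffun 'I_m -> 'I_N} -> A).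
Proof.
move=> xN p0 pq'; rewrite (altsum_push_strip c) //; congr (_ * _).
apply: eq_altsum => be sbe; rewrite push_strip_weight0 //.
by apply: eq_bigr => j _; rewrite pq'.
Qed.

(** The weight at [a = 0] is the indicator function of the partitions without
    columns of odd length.  The slack [m] in the bound [N] pays for the step of
    the induction, in which the bound grows by one with each variable. *)
Lemma littlewood_even m M N : (forall i, x i ^+ M = 0) -> (M + m <= N)%N ->
  \prod_(k < m) \prod_(j < k) (1 - x j * x k) *
    altsum (colweight (colp 0) (fun=> 0) : {ffun 'I_m -> 'I_N} -> A) =
  \prod_(k < m) \prod_(j < k) (x j - x k).
Proof.
move=> xM; have xN K : (M <= K)%N -> forall i, x i ^+ K = 0.
  by move=> leMK i; rewrite -(subnK leMK) exprD xM mulr0.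
elim: m N => [|m IHm] N leN.
  rewrite !big_ord0 mul1r /altsum.
  have al0 : {ffun 'I_0 -> 'I_N} by apply: finfun => -[].
  rewrite (big_pred1 al0); first by rewrite /colweight big_ord0 mul1r /altdet det_mx00.
  move=> al; have -> : al = al0 by apply/ffunP; case.
  by rewrite /= eqxx; apply/forallP; case.
case: N leN => [|N]; rewrite ?addnS // ltnS => leN.
rewrite altsum_branching // !big_ord_recr /= -(IHm N) //.
rewrite (@altsum_stage m N (x m) (colp 0) (colp (x m)) (fun=> 0)) //; last first.
- move=> j r; rewrite /colp /=; case: (odd j) => /=; last by rewrite mulr1.
  by rewrite mulr0 hpredC.
- by apply: xN; lia.
have -> : \prod_(i < m) (1 - x m * x i) = \prod_(i < m) (1 - x i * x m).
  by apply: eq_bigr => i _; rewrite mulrC.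
rewrite (eq_altsum (h := colweight (colp (x m)) (fun=> 0))); first by ring.
move=> be _; apply: eq_bigr => j _; rewrite /colp /=; case: (odd j) => /=.
  by rewrite mulr0.
by rewrite mulr1 hpredC.
Qed.

(** From [littlewood_even], the Pieri rule with [a] and [b] only changes the
    parameters of the weight; the sum for [c] is kept as it is. *)
Lemma three_parameter_alternants m M N (a b c : A) :
  (forall i, x i ^+ M = 0) -> (M + m <= N)%N ->
  \prod_(i < m) ((1 - a * x i) * (1 - b * x i) * (1 - c * x i)) *
    \prod_(k < m) \prod_(j < k) (1 - x j * x k) *
    altsum (push_strip c (colweight (colp a) (colq a b)) : {ffun 'I_m -> 'I_N} -> A) =
  \prod_(k < m) \prod_(j < k) (x j - x k).
Proof.
move=> xM leN; rewrite -(littlewood_even xM leN).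
have xN i : x i ^+ N = 0.
  by rewrite -(subnK (leq_trans (leq_addr m M) leN)) exprD xM mulr0.
rewrite (@altsum_stage m N a (colp 0) (colp a) (fun=> 0)) //; last first.
  move=> j r; rewrite /colp /=; case: (odd j) => /=; last by rewrite mulr1.
  by rewrite mulr0 hpredC.
rewrite (@altsum_stage m N b (colp a) (colp a) (colq a b)) //; last first.
  move=> j r; rewrite /colp /colq /=; case: (odd j) => /=; last by rewrite mulr1 hpredC.
  by rewrite hpredC mulrC.
by rewrite [in RHS](altsum_push_strip c) // !big_split /=; ring.
Qed.

End Stages.

(** * The polynomials h, P and Q as convolutions *)
Section Entries.
Variable R : idomainType.
Local Notation a := (va R).
Local Notation b := (vb R).
Local Notation c := (vc R).
Local Notation K := (strip_conv c (colp a) (colq a b)).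

Definition mon3 k l t : 'X_{1..3} :=
  (U_(0%R : 'I_3) *+ k + U_(1%R : 'I_3) *+ l + U_(2%R : 'I_3) *+ t)%MM.

Lemma mon3E k l t : 'X_[R, mon3 k l t] = a ^+ k * b ^+ l * c ^+ t.
Proof. by rewrite /mon3 !mpolyXD !mpolyXn. Qed.

Lemma mon3_eq k l t (m : 'X_{1..3}) :
  (mon3 k l t == m) =
  [&& k == m (0%R : 'I_3), l == m (1%R : 'I_3) & t == m (2%R : 'I_3)].
Proof.
apply/eqP/and3P => [<-|[/eqP-> /eqP-> /eqP->]].
  by rewrite !mnmDE !mulmnE !mnm1E /= !mul0n !mul1n !addn0 !add0n.
apply/mnmP => i; rewrite !mnmDE !mulmnE !mnm1E.
case: i => [[|[|[|//]]]] i3; rewrite /= !mul0n !mul1n ?addn0 ?add0n;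
  by congr (_ _); apply: val_inj.
Qed.

Lemma mdeg3 (m : 'X_{1..3}) :
  mdeg m = (m (0%R : 'I_3) + m (1%R : 'I_3) + m (2%R : 'I_3))%N.
Proof.
rewrite mdegE !big_ord_recl big_ord0 addn0 addnA.
by congr (_ + _ + _)%N; congr (m _); apply: val_inj.
Qed.

(** Both sides are the sum of all the monomials of degree [d]; on the right
    they are sorted by the exponent of [c]. *)
Lemma hpol_complete d :
  hpol R (Posz d) = \sum_(t < d.+1) c ^+ t * hpred a b (d.+1 - t).
Proof.
apply/mpolyP => m; rewrite /hpol !raddf_sum /=.
under eq_bigr do rewrite mcoeffX.
have -> : \sum_(i : 'X_{1..3 < d.+1} | mdeg i == d) ((val i == m)%:R : R) =
          (mdeg m == d)%:R.
  have [dm|ndm] := boolP (mdeg m == d); last first.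
    by rewrite big1 // => i di; case: eqP => // im; rewrite -im di in ndm.
  have ltm : (mdeg m < d.+1)%N by rewrite (eqP dm).
  rewrite (bigD1 (BMultinom ltm)) //= eqxx big1 ?addr0 // => i /andP[_ ni].
  by move: ni; rewrite bmeqP => /negPf ->.
transitivity (\sum_(t < d.+1) \sum_(k < d.+1 - t)
   ((mon3 k ((d.+1 - t).-1 - k) t == m)%:R : R)); last first.
  apply: eq_bigr => t _; rewrite /hpred mulr_sumr raddf_sum; apply: eq_bigr => k _.
  by rewrite /= mulrC -mon3E mcoeffX.
under eq_bigr do under eq_bigr do rewrite mon3_eq.
have [dm|ndm] := eqVneq (mdeg m) d; last first.
  rewrite big1 // => t _; rewrite big1 // => k _.
  case: and3P => // -[/eqP e0 /eqP e1 /eqP e2]; case/eqP: ndm.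
  by rewrite mdeg3 -e0 -e1 -e2; have := ltn_ord k; have := ltn_ord t; lia.
rewrite mdeg3 in dm.
have lt2 : (m (2%R : 'I_3) < d.+1)%N by lia.
rewrite (bigD1 (Ordinal lt2)) //= [X in _ + X]big1 ?addr0; last first.
  move=> t nt; rewrite big1 // => k _; rewrite (_ : t == _ :> nat = false) ?andbF //.
  by apply: contraNF nt => /eqP e; apply/eqP/val_inj.
have lt0 : (m (0%R : 'I_3) < d.+1 - m (2%R : 'I_3))%N by lia.
rewrite (bigD1 (Ordinal lt0)) //= big1 ?addr0; last first.
  move=> k nk; rewrite (_ : k == _ :> nat = false) //.
  by apply: contraNF nk => /eqP e; apply/eqP/val_inj.
by rewrite !eqxx andbT (_ : _ == _ = true) //; apply/eqP; lia.
Qed.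

Lemma hpolE d : hpol R (Posz d) = K 0 d.+1.
Proof.
rewrite hpol_complete /strip_conv; apply: eq_bigr => t _.
by rewrite [colp _ 0]/= [colq _ _ 0]/= hpred10 mulr1.
Qed.

Lemma PpolE i d : Ppol R (Posz d) = K i.*2.+1 d.+1.
Proof.
have neqX (m m' : 'X_{1..3}) : m != m' -> 'X_[R, m] - 'X_[R, m'] != 0.
  move=> nm; apply/eqP => /(congr1 (mcoeff m)) /eqP.
  by rewrite mcoeffB !mcoeffX eqxx [m' == m]eq_sym (negPf nm) subr0 mcoeff0 oner_eq0.
have ab0 : a - b != 0 by apply: neqX; apply/eqP => /mnmP /(_ 0); rewrite !mnm1E.
have ab1 : 1 - a * b != 0.
  rewrite -mpolyX0 -mpolyXD; apply: neqX.
  by apply/eqP => /mnmP /(_ 0); rewrite mnmDE !mnm1E mnm0E.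
rewrite /Ppol /strip_conv; apply: eq_bigr => k _.
have -> : exquo (a ^+ k.+1 - b ^+ k.+1) (a - b) = hpred a b k.+1.
  by rewrite -mul_subr_hpred mulrC exquoK.
have -> : exquo (1 - (a * b) ^+ (d - k).+1) (1 - a * b) = hpred 1 (a * b) (d - k).+1.
  by rewrite -[X in X - _](expr1n _ (d - k).+1) -mul_subr_hpred mulrC exquoK.
rewrite /colp /colq /= !odd_double /= subSn; last by rewrite -ltnS.
by ring.
Qed.

(** Both sides satisfy [Q_{d+1} = h_{d+1}(a, b, c) + a b c Q_d]: on the right,
    from [h_{t+1}(1, ab) = 1 + ab h_t(1, ab)]. *)
Lemma QpolE i d : Qpol R (Posz d) = K i.*2.+2 d.+1.
Proof.
pose G r := \sum_(t < r) c ^+ t * hpred a b (r - t) * hpred 1 (a * b) t.+1.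
have -> : K i.*2.+2 d.+1 = G d.+1.
  by apply: eq_bigr => t _; rewrite /colp /colq /= !odd_double.
rewrite /Qpol; elim: d => [|d IHd].
  rewrite big_ord1 /G big_ord1 /= !expr0 mulr1 mul1r subn0 !hpred1 mulr1.
  by move: (hpol_complete 0); rewrite big_ord1 /= expr0 mul1r hpred1.
rewrite big_ord_recl expr0 mulr1 subr0.
transitivity (hpol R d.+1 + a * b * c * G d.+1).
  rewrite -IHd mulr_sumr; congr (_ + _); apply: eq_bigr => k _.
  rewrite /= /bump add1n exprS [RHS]mulrCA; congr (hpol R _ * _); lia.
rewrite hpol_complete /G !mulr_sumr [in RHS]big_ord_recl [in LHS]big_ord_recl.
rewrite !expr0 !mul1r hpred1 mulr1 -addrA -big_split; congr (_ + _).
apply: eq_bigr => t _; rewrite /= /bump add1n subSS [hpred 1 _ t.+2]hpredS expr1n exprS.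
by ring.
Qed.

End Entries.

(** * The coefficient as a sum over horizontal strips *)
Lemma foldr_delta (xi : nat -> int) s j : uniq s ->
  foldr delta xi s j = xi j - (j \in s)%:R - ((0 < j)%N && (j.-1 \in s))%:R.
Proof.
elim: s => [|i s IHs] /=; first by rewrite andbF !subr0.
move=> /andP[nis us]; rewrite /delta IHs // !inE.
have e1 : (j == i)%:R + (j \in s)%:R = ((j == i) || (j \in s))%:R :> int.
  by have [->|_] := eqVneq j i; rewrite ?(negPf nis) ?addr0 ?add0r.
have e2 : (j == i.+1)%:R + ((0 < j)%N && (j.-1 \in s))%:R =
          ((0 < j)%N && ((j.-1 == i) || (j.-1 \in s)))%:R :> int.
  case: j {e1 IHs} => [|j] //=; rewrite eqSS.
  by have [->|_] := eqVneq j i; rewrite ?(negPf nis) ?addr0 ?add0r.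
by rewrite -e1 -e2; ring.
Qed.

Section Strips.
Variables (n N : nat).
Implicit Type al : {ffun 'I_n -> 'I_N}.

Lemma strict_ge al : strict al -> forall j : 'I_n, (n - j.+1 <= al j)%N.
Proof.
move=> /forallP sal j; have [d] := ubnP (n - j.+1)%N.
elim: d j => // d IHd j ltd; have [ltjn|lejn] := ltnP j.+1 n; last first.
  by rewrite (_ : n - j.+1 = 0)%N //; apply/eqP; rewrite subn_eq0.
have := sal j; rewrite (succ_atE al (Ordinal ltjn)); apply: leq_trans.
have /= := IHd (Ordinal ltjn); lia.
Qed.

(** The partition of a strictly decreasing sequence of exponents. *)
Definition part_of al : n.-tuple nat := [tuple (al j - (n - j.+1))%N | j < n].

Lemma part_ofE al : strict al ->
  forall j : 'I_n, (tnth (part_of al) j + (n - j.+1))%N = al j.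
Proof. by move=> sal j; rewrite tnth_mktuple subnK // strict_ge. Qed.

Lemma nth_part_of al (j : 'I_n) : nth 0%N (part_of al) j = (al j - (n - j.+1))%N.
Proof. by rewrite -tnth_nth tnth_mktuple. Qed.

Lemma Gamma_part_of al (j : 'I_n) : strict al -> Gamma (part_of al) j = gap al j.
Proof.
move=> sal; rewrite /Gamma /gap nth_part_of.
have sj := forallP sal j; have gej := strict_ge sal j.
have [ltjn|lejn] := ltnP j.+1 n; last first.
  rewrite nth_default ?size_tuple // succ_at_ge // subr0 subn0.
  by rewrite (_ : n - j.+1 = 0)%N ?subn0 //; apply/eqP; rewrite subn_eq0.
have := strict_ge sal (Ordinal ltjn); have := sj.
rewrite (succ_atE al (Ordinal ltjn)) (nth_part_of al (Ordinal ltjn)) /= => ? ?.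
by rewrite subzn; [congr Posz | ]; lia.
Qed.

Lemma part_of_sorted al : strict al -> sorted geq (part_of al).
Proof.
move=> sal; apply/(sortedP 0%N) => j; rewrite size_tuple => ltjn.
have := Gamma_part_of (Ordinal (ltnW ltjn)) sal; rewrite /Gamma /=; lia.
Qed.

End Strips.

Lemma prev_in_gt m (S : {set 'I_m}) k : (m < k)%N -> prev_in S k = false.
Proof.
move=> ltmk; apply/negbTE; rewrite /prev_in negb_and; apply/orP; left.
by apply/exists_inP => -[j _ /eqP e]; have := ltn_ord j; rewrite e; lia.
Qed.

Lemma mem_enum_prev_in m (S : {set 'I_m}) k : (k \in map val (enum S)) = prev_in S k.+1.
Proof.
rewrite /prev_in andbT /=; apply/mapP/exists_inP => [[j]|[j jS /eqP <-]].
  by rewrite mem_enum => jS ->; exists j.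
by exists j; rewrite ?mem_enum.
Qed.

Lemma enum_set_sorted m (S : {set 'I_m}) : sorted ltn (map val (enum S)).
Proof.
apply: (subseq_sorted ltn_trans _ (iota_ltn_sorted 0 m)).
by rewrite -val_enum_ord map_subseq // enumT; apply: filter_subseq.
Qed.

Section Coefficient.
Variable R : idomainType.
Local Notation a := (va R).
Local Notation b := (vb R).
Local Notation c := (vc R).
Local Notation K := (strip_conv c (colp a) (colq a b)).

(** The factor of index [j] in the product [Fpol]. *)
Definition entry (j : nat) (r : int) : {mpoly R[3]} :=
  if j is 0%N then hpol R r else if odd j then Ppol R r else Qpol R r.

Lemma entry_Posz j d : entry j (Posz d) = K j d.+1.
Proof.
case: j => [|j]; first exact: hpolE.
have := odd_double_half j; case: (odd j) => <-; rewrite /entry /= ?add1n /= odd_double.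
  exact: QpolE.
exact: PpolE.
Qed.

Lemma entry_Negz j d : entry j (Negz d) = 0.
Proof. by rewrite /entry; case: j => // j; case: odd. Qed.

Lemma entry0 j : entry j 0 = 1.
Proof.
by rewrite (entry_Posz j 0) /strip_conv big_ord1 expr0 mul1r subn0 !hpred1 mulr1.
Qed.

Lemma entry_shift j d (s s' : bool) :
  entry j (Posz d - s%:R - s'%:R) = K j (d.+1 - s - s').
Proof.
case: s s' => [] []; rewrite ?subr0 ?subn0 ?subn1 /= ?entry_Posz //.
- case: d => [|[|d]].
  + by rewrite (_ : 0%:Z - 1 - 1 = Negz 1) // entry_Negz /strip_conv big_ord0.
  + by rewrite (_ : 1%:Z - 1 - 1 = Negz 0) // entry_Negz /strip_conv big_ord0.
  + by rewrite (_ : d.+2%:Z - 1 - 1 = d) ?entry_Posz //; lia.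
- case: d => [|d]; first by rewrite entry_Negz /strip_conv big_ord0.
  by rewrite (_ : d.+1%:Z - 1 = d) ?entry_Posz //; lia.
- case: d => [|d]; first by rewrite entry_Negz /strip_conv big_ord0.
  by rewrite (_ : d.+1%:Z - 1 = d) ?entry_Posz //; lia.
Qed.

Lemma prod_eventually1 (F : nat -> {mpoly R[3]}) k d :
  (forall j, (k <= j)%N -> F j = 1) -> \prod_(j < k + d) F j = \prod_(j < k) F j.
Proof.
move=> F1; elim: d => [|d IHd]; first by rewrite addn0.
by rewrite addnS big_ord_recr /= IHd F1 ?mulr1 // leq_addr.
Qed.

Lemma FpolE xi k : (forall j, (k <= j)%N -> xi j = 0) ->
  Fpol R xi = \prod_(j < k) entry j (xi j).
Proof.
move=> xi0; have e1 j : (k <= j)%N -> entry j (xi j) = 1.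
  by move=> lej; rewrite xi0 // entry0.
rewrite -(prod_eventually1 k.+1 e1) addnS addnn.
rewrite /Fpol -(@fsbig_widen _ _ _ _ `I_k) //; last first.
  move=> i /= [_ /negP]; rewrite -leqNgt => leki.
  have o1 : entry i.*2.+1 (xi i.*2.+1) = 1 by apply: e1; lia.
  have o2 : entry i.*2.+2 (xi i.*2.+2) = 1 by apply: e1; lia.
  by move: o1 o2; rewrite /entry /= odd_double /= => -> ->; rewrite mulr1.
rewrite -(fsbig_ord _ k); elim: k {xi0 e1} => [|k IHk].
  by rewrite big_ord0 mulr1 big_ord1.
rewrite big_ord_recr mulrA IHk /= doubleS !big_ord_recr /= odd_double /=.
by rewrite mulrA.
Qed.

Lemma Fpol_negative xi k j d : (forall i, (k <= i)%N -> xi i = 0) ->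
  xi j = Negz d -> Fpol R xi = 0.
Proof.
move=> xi0 xij; have ltjk : (j < k)%N.
  by rewrite ltnNge; apply/negP => /xi0; rewrite xij.
by rewrite (FpolE xi0) (bigD1 (Ordinal ltjk)) //= xij entry_Negz mul0r.
Qed.

(** A tuple with an index [i >= n] contributes nothing: if [i] is its largest
    index, the entry [i + 1] of the shifted sequence is [-1].  The other tuples
    list the subsets of [{0, ..., n - 1}] in increasing order. *)
Lemma fpol_sets n (lam : n.-tuple nat) :
  fpol R lam = \sum_(S : {set 'I_n})
    (- (a * b * c)) ^+ #|S| * Fpol R (foldr delta (Gamma lam) (map val (enum S))).
Proof.
have Gamma0 j : (n <= j)%N -> Gamma lam j = 0.
  by move=> lenj; rewrite /Gamma !nth_default ?subrr ?size_tuple // leqW.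
rewrite (partition_big (fun S : {set 'I_n} => inord #|S| : 'I_n.+1) xpredT) //=.
apply: eq_bigr => k _.
have card_k (S : {set 'I_n}) : (inord #|S| == k) = (#|S| == k).
  by rewrite -val_eqE /= inordK // ltnS -[X in (_ <= X)%N]card_ord max_card.
transitivity ((- (a * b * c)) ^+ k * \sum_(S : {set 'I_n} | #|S| == k)
    Fpol R (foldr delta (Gamma lam) (map val (enum S)))); last first.
  by rewrite mulr_sumr; apply: eq_big => [S|S /eqP <-] //; rewrite card_k.
congr (_ * _).
pose tup (S : {set 'I_n}) : k.-tuple nat :=
  insubd (nseq_tuple k 0%N) (map val (enum S)).
have tupE (S : {set 'I_n}) :
    #|S| == k -> val (tup S) = map val (enum S) :> seq nat.
  by move=> Sk; rewrite insubdK // unfold_in size_map -cardE.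
pose r := [seq tup B | B <- [seq B : {set 'I_n} <- enum {set 'I_n} | #|B| == k]].
have rP s : reflect (exists2 B : {set 'I_n}, #|B| == k & s = tup B) (s \in r).
  apply: (iffP mapP) => [[S]|[S Sk ->]].
    by rewrite mem_filter => /andP[Sk _] ->; exists S.
  by exists S; rewrite // mem_filter Sk mem_enum.
rewrite (@fsbigE _ _ _ _ _ r).
- rewrite big_seq_cond (eq_bigl (mem r)); last first.
    move=> s; rewrite /= andb_idr // => /rP[S Sk ->].
    by rewrite inE /= (tupE S Sk) enum_set_sorted.
  rewrite -big_seq big_map big_filter big_enum_cond /=.
  by apply: eq_bigr => S Sk; rewrite -(tupE S Sk).
- rewrite map_inj_in_uniq => [|S S']; first exact: filter_uniq (enum_uniq _).
  rewrite !mem_filter => /andP[Sk _] /andP[S'k _] eSS'.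
  have /(inj_map val_inj) e : map val (enum S) = map val (enum S').
    by rewrite -(tupE S) // -(tupE S') // eSS'.
  by apply/setP => i; rewrite -mem_enum e mem_enum.
- by move=> s /rP[S Sk ->] /=; rewrite (tupE S Sk) enum_set_sorted.
move=> s /= sorted_s nrs.
have us : uniq s by apply: (sorted_uniq ltn_trans ltnn).
have [/hasP[i is_ lei]|/hasPn alls] := boolP (has (leq n) s).
  have bnd j : (j \in val s) -> (j <= \max_(l <- val s) l)%N.
    by move=> js; apply: (@leq_bigmax_seq _ _ xpredT id).
  have [i0 i0s maxi0] := ex_maxnP (ex_intro _ i is_) bnd.
  have lei0 : (n <= i0)%N by apply: leq_trans (maxi0 _ is_).
  apply: (@Fpol_negative _ i0.+2 i0.+1 0).
    move=> j ltj; rewrite foldr_delta // Gamma0 ?sub0r; last by lia.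
    rewrite (_ : j \in _ = false); last first.
      by apply/negP => /maxi0; lia.
    rewrite (_ : j.-1 \in _ = false) ?andbF //.
    by apply/negP => /maxi0; lia.
  rewrite foldr_delta // Gamma0 ?sub0r; last by lia.
  rewrite /= (_ : i0 \in _ = true) // (_ : i0.+1 \in _ = false) //.
  by apply/negP => /maxi0; rewrite ltnn.
case/negP: nrs; pose S : {set 'I_n} := [set i | val i \in val s]%SET.
have eS : map val (enum S) = s.
  apply: (irr_sorted_eq ltn_trans ltnn) (enum_set_sorted S) sorted_s _ => i.
  apply/mapP/idP => [[j]|is_]; first by rewrite mem_enum inE => js ->.
  have ltin : (i < n)%N by rewrite ltnNge alls.
  by exists (Ordinal ltin); rewrite // mem_enum inE.
have Sk : #|S| == k by rewrite cardE -(size_map val) eS size_tuple.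
by apply/rP; exists S => //; apply: val_inj; rewrite tupE.
Qed.

(** [push_strip_weight] and [fpol_sets] are the same sum over the sets [S], term
    by term.  If [n - 1] is in [S] then the entry [n] is [-1], which accounts for
    the indicator in [push_strip_weight]. *)
Lemma fpol_push_strip n N (al : {ffun 'I_n -> 'I_N}) : strict al ->
  fpol R (part_of al) = push_strip c (colweight (colp a) (colq a b)) al.
Proof.
move=> sal; rewrite fpol_sets push_strip_weight //; apply: eq_bigr => S _.
have uS : uniq (map val (enum S)) by rewrite (map_inj_uniq val_inj) enum_uniq.
set xi := foldr _ _ _.
have xiE j : xi j = Gamma (part_of al) j - (prev_in S j.+1)%:R - (prev_in S j)%:R.
  rewrite /xi foldr_delta // mem_enum_prev_in.
  by case: j => [|j]; rewrite ?prev_in0 ?mem_enum_prev_in.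
have Gamma0 j : (n <= j)%N -> Gamma (part_of al) j = 0.
  by move=> lenj; rewrite /Gamma !nth_default ?subrr ?size_tuple // leqW.
rewrite (@FpolE _ n.+1) => [|j ltnj]; last first.
  by rewrite xiE Gamma0 1?ltnW // !prev_in_gt // 1?ltnW.
rewrite big_ord_recr /= xiE Gamma0 // prev_in_gt // (entry_shift n 0 false).
have -> : K n (1 - false - prev_in S n) = (~~ prev_in S n)%:R.
  rewrite subn0; case: prev_in; first by rewrite /strip_conv big_ord0.
  by rewrite /strip_conv big_ord1 expr0 mul1r !hpred1 mulr1.
rewrite mulrA mulrC; congr (_ * _).
have -> : (- (a * b * c)) ^+ #|S| =
          \prod_(j < n) (- (c * (colp a j.+1 * colq a b j.+1))) ^+ prev_in S j.+1.
  rewrite -prodr_const big_mkcond /=; apply: eq_bigr => j _; rewrite prev_inS.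
  case: (j \in S) => //=; rewrite expr1 /colp /colq /=.
  by case: (odd j) => /=; ring.
rewrite -big_split; apply: eq_bigr => j _ /=.
by rewrite xiE Gamma_part_of // entry_shift.
Qed.

End Coefficient.

(** * Alternants and the Vandermonde determinant *)
Section Vandermonde.
Variables (A : comNzRingType) (x : nat -> A).
Local Notation vdm m := (\prod_(k < m) \prod_(j < k) (x j - x k)).

Lemma prod_pairs n (F : nat -> nat -> A) :
  \prod_(k < n) \prod_(j < k) F j k = \prod_(j < n) \prod_(k < n | (j < k)%N) F j k.
Proof.
rewrite (exchange_big_dep xpredT) //=; apply: eq_bigr => k _.
by rewrite (big_ord_widen n (fun j => F j k)) // ltnW.
Qed.

(** By induction on the number of variables: the branching rule extracts the
    factors that contain the last one. *)
Lemma altdet_dvd m N (al : {ffun 'I_m -> 'I_N}) : strict al ->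
  exists r, altdet x al = r * vdm m.
Proof.
elim: m N al => [|m IHm] N al sal.
  by exists 1; rewrite /altdet det_mx00 big_ord0 mulr1.
case: N al sal => [al|N al sal]; first by case: (al ord0).
rewrite branching // big_ord_recr /=.
suff [r ->] : exists r, \sum_(be : {ffun 'I_m -> 'I_N})
    (x m ^+ al ord_max *
     \prod_(j < m) (if (succ_at al j.+1 <= (be j).+1 <= al (widen_ord (leqnSn m) j))%N
                    then x m ^+ (al (widen_ord (leqnSn m) j) - (be j).+1) else 0))
    * altdet x be = r * vdm m.
  by exists r; rewrite mulrCA [X in _ * X]mulrC.
apply: (big_ind (fun z => exists r, z = r * vdm m)) => [|_ _ [r ->] [s ->]|be _].
- by exists 0; rewrite mul0r.
- by exists (r + s); rewrite mulrDl.
rewrite branching_kernel prod_if; case: ifP => [win|_]; last first.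
  by exists 0; rewrite !mul0r.
have /IHm[r ->] : strict be.
  by move/strip_at_strict: win; rewrite strict_prepend => /andP[].
by eexists; rewrite mulrA.
Qed.

(** Reversing both the variables and the exponents does not change the
    determinant and leads to the matrix of [det_Vandermonde]. *)
Lemma det_reversed_vandermonde n :
  \det (\matrix_(i < n, j < n) x i ^+ (n - j.+1)) = vdm n.
Proof.
pose s : 'S_n := perm (@rev_ord_inj n).
pose V := Vandermonde n (\row_(j < n) x (rev_ord j)).
transitivity (\det (row_perm s (col_perm s V^T))).
  congr (\det _); apply/matrixP => i j.
  by rewrite !mxE !permE; congr (x _ ^+ _); rewrite /=; have := ltn_ord i; lia.
rewrite row_permE col_permE !det_mulmx !det_perm odd_permV mulrCA -signr_addb addbb.
rewrite mulr1 det_tr det_Vandermonde (reindex_inj rev_ord_inj) /=.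
apply: eq_bigr => k _; rewrite (reindex_inj rev_ord_inj) /=.
rewrite (big_ord_widen n (fun j => x j - x k)) 1?ltnW //.
apply: eq_big => [j|j _]; first by have := ltn_ord j; have := ltn_ord k; lia.
rewrite !mxE; congr (x _ - x _); rewrite /=.
  by have := ltn_ord j; lia.
by have := ltn_ord k; lia.
Qed.

End Vandermonde.

Section Morphism.
Variables (A B : comNzRingType) (f : {rmorphism A -> B}).

Lemma hpred_rmorph p q r : f (hpred p q r) = hpred (f p) (f q) r.
Proof. by rewrite rmorph_sum; apply: eq_bigr => k _; rewrite rmorphM !rmorphXn. Qed.

Lemma altdet_rmorph x m N (al : {ffun 'I_m -> 'I_N}) :
  f (altdet x al) = altdet (f \o x) al.
Proof.
rewrite /altdet -det_map_mx; congr (\det _).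
by apply/matrixP => i j; rewrite !mxE rmorphXn.
Qed.

Lemma push_strip_rmorph c p q p' q' m N (be : {ffun 'I_m -> 'I_N}) :
  (forall k, f (p k) = p' k) -> (forall k, f (q k) = q' k) ->
  f (push_strip c (colweight p q) be) = push_strip (f c) (colweight p' q') be.
Proof.
move=> fp fq; rewrite rmorph_sum; apply: eq_bigr => al _.
rewrite rmorphM !rmorph_prod; congr (_ * _); apply: eq_bigr => j _.
  by case: ifP => _; rewrite ?rmorphXn ?rmorph0.
by rewrite hpred_rmorph fp fq.
Qed.

End Morphism.

(** * Polynomials up to a given degree *)
Section LowDegree.
Variables (n : nat) (K : idomainType).
Implicit Types p q w : {mpoly K[n]}.

Definition vanish_upto N : {pred {mpoly K[n]}} :=
  fun p => all (fun m => N < mdeg m)%N (msupp p).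

Lemma vanish_uptoP N p :
  reflect (forall m, (mdeg m <= N)%N -> p@_m = 0) (p \in vanish_upto N).
Proof.
apply: (iffP allP) => [low m lem|low m]; last first.
  by rewrite mcoeff_msupp ltnNge; apply: contraNN => /low ->.
by apply/eqP; rewrite mcoeff_eq0; apply: contraL lem => /low; rewrite ltnNge.
Qed.

Lemma vanish_upto_ideal N : idealr_closed (vanish_upto N).
Proof.
split=> [||u p q /vanish_uptoP lp /vanish_uptoP lq].
- by apply/vanish_uptoP => m; rewrite mcoeff0.
- apply/negP => /vanish_uptoP /(_ 0%MM); rewrite mdeg0 mcoeff1 eqxx => /(_ isT) /eqP.
  by rewrite oner_eq0.
apply/vanish_uptoP => m lem; rewrite mcoeffD lq // addr0 mcoeffM.
apply: big1 => -[k1 k2] /= /eqP em; rewrite [p@_ _]lp ?mulr0 //.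
have := congr1 mdeg em; rewrite mdegD => e2; apply: leq_trans lem.
by rewrite [X in (_ <= X)%N]e2 leq_addl.
Qed.

Lemma pihomog_mulr d e w p : w \is d.-homog for mdeg ->
  pihomog mdeg (d + e) (w * p) = w * pihomog mdeg e p.
Proof.
move=> hw.
rewrite {1}(pihomog_partitionE (mf := mdeg) (leq_addr e.+1 (mmeasure mdeg p))).
rewrite mulr_sumr raddf_sum /=.
have lte : (e < mmeasure mdeg p + e.+1)%N by rewrite addnS ltnS leq_addl.
rewrite (bigD1 (Ordinal lte)) //= big1 ?addr0.
  by rewrite pihomog_dE //; apply: dhomogM => //; apply: pihomogP.
move=> i ni; apply: (@pihomog_ne0 _ _ _ (d + i)); first by rewrite eqn_add2l.
exact: dhomogM hw (pihomogP _ _ _).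
Qed.

(** Multiplication by [w] shifts the homogeneous components by [d]
    ([pihomog_mulr]) and is injective on each of them. *)
Lemma vanish_homog_div d N w p : w != 0 -> w \is d.-homog for mdeg ->
  w * p \in vanish_upto (d + N) -> p \in vanish_upto N.
Proof.
move=> w0 hw /vanish_uptoP low; apply/vanish_uptoP => m lem.
have : pihomog mdeg (mdeg m) p = 0.
  apply: (mulfI w0); rewrite mulr0 -(pihomog_mulr _ _ hw) pihomogE big1_seq //.
  move=> m' /andP[/eqP em' _]; rewrite low ?scale0r //.
  by rewrite [mdeg _]em' leq_add2l.
move/(congr1 (mcoeff m)).
rewrite (pihomogwE _ _ (leq_addr (mdeg m).+1 (msize p))) raddf_sum mcoeff0.
have ltm : (mdeg m < msize p + (mdeg m).+1)%N by rewrite addnS ltnS leq_addl.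
rewrite (bigD1 (BMultinom ltm)) //= mcoeffZ mcoeffX eqxx mulr1 big1 ?addr0 //.
move=> m' /andP[_ nm']; rewrite mcoeffZ mcoeffX.
suff /negbTE -> : (m' : 'X_{1..n}) != m by rewrite mulr0.
by move: nm'; rewrite bmeqP.
Qed.

(** The variables indexed by [nat], as the induction on their number requires. *)
Definition varX (k : nat) : {mpoly K[n]} := if insub k is Some i then 'X_i else 0.

Lemma varXE (i : 'I_n) : varX i = 'X_i.
Proof. by rewrite /varX valK. Qed.

Lemma varX_homog (i : 'I_n) : varX i \is 1.-homog for mdeg.
Proof. by rewrite varXE dhomogX /= mdeg1. Qed.

Lemma prod_homog I (r : seq I) (P : pred I) (F : I -> {mpoly K[n]}) (d : I -> nat) :
  (forall i, P i -> F i \is (d i).-homog for mdeg) ->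
  \prod_(i <- r | P i) F i \is (\sum_(i <- r | P i) d i).-homog for mdeg.
Proof.
move=> hF; apply: (big_ind2 (fun p e => p \is e.-homog for mdeg)) => //.
- exact: dhomog1.
- by move=> p d1 q d2; apply: dhomogM.
Qed.

Lemma alternant_homog (al : 'I_n -> nat) :
  \det (\matrix_(i < n, j < n) varX i ^+ al j) \is (\sum_j al j).-homog for mdeg.
Proof.
apply: rpred_sum => s _; rewrite rpredMsign.
have hprod : \prod_i (\matrix_(i < n, j < n) varX i ^+ al j) i (s i)
      \is (\sum_i al (s i)).-homog for mdeg.
  apply: prod_homog => i _; rewrite mxE.
  by have := dhomogMn (al (s i)) (varX_homog i); rewrite mul1n.
suff -> : (\sum_j al j = \sum_j al (s j))%N by [].
exact: (reindex_inj (@perm_inj _ s)).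
Qed.

Local Notation vdm := (\prod_(k < n) \prod_(j < k) (varX j - varX k)).

Lemma vdm_neq0 : vdm != 0.
Proof.
apply/prodf_neq0 => k _; apply/prodf_neq0 => j _.
pose j' := widen_ord (ltnW (ltn_ord k)) j.
have jk : j' != k by apply/eqP => /(congr1 val) /= e; have := ltn_ord j; lia.
rewrite -[X in varX X - _]/(val j') !varXE; apply/eqP => /(congr1 (mcoeff U_(j'))) /eqP.
rewrite mcoeffB !mcoeffX eqxx mcoeff0.
rewrite (_ : (U_(k) == U_(j'))%MM = false) ?subr0 ?oner_eq0 //.
by apply/negP => /eqP /mnmP /(_ k) /eqP; rewrite !mnm1E eqxx (negPf jk).
Qed.

Lemma vdm_alternant : vdm = alternant K (fun=> 0%N : nat) :> {mpoly K[n]}.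
Proof.
rewrite -det_reversed_vandermonde /alternant; congr (\det _).
by apply/matrixP => i j; rewrite !mxE varXE.
Qed.

Lemma vdm_homog : vdm \is (\sum_(j < n) (n - j.+1)).-homog for mdeg.
Proof. by rewrite -det_reversed_vandermonde; apply: alternant_homog. Qed.

(** The quotient that defines the Schur function is exact by [altdet_dvd]. *)
Lemma schur_altdet N (al : {ffun 'I_n -> 'I_N}) : strict al ->
  schur K (part_of al) * vdm = altdet varX al.
Proof.
move=> sal; have [r er] := altdet_dvd varX sal.
have eal : alternant K (tnth (part_of al)) = altdet varX al.
  rewrite /alternant /altdet; congr (\det _); apply/matrixP => i j.
  by rewrite !mxE varXE part_ofE.
by rewrite /schur eal -vdm_alternant er exquoK // vdm_neq0.
Qed.

(** The alternant and the Vandermonde determinant are homogeneous, of degrees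
    that differ by the size of the partition. *)
Lemma schur_low N (al : {ffun 'I_n -> 'I_N}) m : strict al ->
  (mdeg m < \sum_(j < n) tnth (part_of al) j)%N -> (schur K (part_of al))@_m = 0.
Proof.
move=> sal ltm; set s := schur K _.
have : s \in vanish_upto (mdeg m); last by move/vanish_uptoP; apply.
apply: (vanish_homog_div vdm_neq0 vdm_homog); apply/vanish_uptoP => m' lem'.
rewrite mulrC schur_altdet // (dhomog_nemf_coeff (alternant_homog _)) //.
apply: contraTneq lem' => ->; rewrite -ltnNge.
have -> : (\sum_j al j = \sum_(j < n) (n - j.+1) + \sum_(j < n) tnth (part_of al) j)%N.
  by rewrite -big_split; apply: eq_bigr => j _; rewrite /= addnC part_ofE.
by rewrite ltn_add2l.
Qed.

Lemma part_of_surj (lam : n.-tuple nat) N : sorted geq lam ->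
  (forall j, tnth lam j + n <= N)%N ->
  exists2 al : {ffun 'I_n -> 'I_N}, strict al & part_of al = lam.
Proof.
move=> slam lamN.
have ltN (j : 'I_n) : (tnth lam j + (n - j.+1) < N)%N.
  by have := lamN j; have := ltn_ord j; lia.
pose al : {ffun 'I_n -> 'I_N} := [ffun j => Ordinal (ltN j)].
exists al; last by apply: eq_from_tnth => j; rewrite tnth_mktuple ffunE /= addnK.
apply/forallP => j; have [ltjn|lejn] := ltnP j.+1 n; last by rewrite succ_at_ge.
rewrite (succ_atE al (Ordinal ltjn)) !ffunE /= !(tnth_nth 0%N) /=.
have := sortedP 0%N slam j; rewrite size_tuple => /(_ ltjn) /=; lia.
Qed.

End LowDegree.

(** An abstract form of the quotient ring: computing in the concrete one would
    let unification unfold its construction. *)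
Lemma ideal_quotient (P : comNzRingType) (I : {pred P}) : idealr_closed I ->
  exists (Q : comNzRingType) (f : {rmorphism P -> Q}),
    forall u v, f u = f v <-> u - v \in I.
Proof.
move=> Iid; pose ic := isIdealr.Build P I Iid.
pose J : idealr P := HB.pack I ic.
exists {ideal_quot J}, \pi_({ideal_quot J})%qT => u v.
by rewrite [_ \in _](Quotient.idealrBE J); split => [->|/eqP].
Qed.

(** * The identity of formal power series *)
Section Assembly.
Variables (R : idomainType) (n : nat).
Local Notation a := (va R).
Local Notation b := (vb R).
Local Notation c := (vc R).
Local Notation K := {mpoly R[3]}.
Local Notation x := (varX n K).
Local Notation vdm := (\prod_(k < n) \prod_(j < k) (x j - x k)).

Definition denominator : {mpoly K[n]} :=
  \prod_(i < n) ((1 - a%:MP * x i) * (1 - b%:MP * x i) * (1 - c%:MP * x i)) *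
  \prod_(k < n) \prod_(j < k) (1 - x j * x k).

Definition partial_sum N : {mpoly K[n]} :=
  \sum_(al : {ffun 'I_n -> 'I_N} | strict al)
     fpol R (part_of al) *: schur K (part_of al).

Lemma varX_nilpotent N k : x k ^+ N.+1 \in @vanish_upto n K N.
Proof.
apply/vanish_uptoP => m lem; rewrite /varX; case: insubP => [i _ _|_].
  rewrite mpolyXn mcoeffX; case: eqP => // em.
  by move: lem; rewrite -em mdegMn mdeg1 mul1n ltnn.
by rewrite expr0n mcoeff0.
Qed.

Lemma partial_sum_vdm N : partial_sum N * vdm =
  \sum_(al : {ffun 'I_n -> 'I_N} | strict al)
     push_strip (c%:MP) (colweight (colp a%:MP) (colq a%:MP b%:MP)) al * altdet x al.
Proof.
rewrite /partial_sum mulr_suml; apply: eq_bigr => al sal.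
rewrite -scalerAl schur_altdet // -mul_mpolyC fpol_push_strip //; congr (_ * _).
apply: (push_strip_rmorph (f := @mpolyC n K)) => k.
  by rewrite /colp; case: ifP; rewrite ?rmorph1.
by rewrite /colq; case: k => [|k]; rewrite ?rmorph0 //; case: ifP; rewrite ?rmorphM.
Qed.

(** Applied to a quotient in which the variables are nilpotent, this transports
    [three_parameter_alternants] back to polynomials. *)
Lemma rmorph_partial_sum (Q : comNzRingType) (f : {rmorphism {mpoly K[n]} -> Q}) N :
  (forall k, f (x k) ^+ N = 0) -> f (partial_sum (N + n) * denominator * vdm) = f vdm.
Proof.
move=> xN.
have fvdm : f vdm = \prod_(k < n) \prod_(j < k) ((f \o x) j - (f \o x) k).
  rewrite rmorph_prod; apply: eq_bigr => k _; rewrite rmorph_prod.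
  by apply: eq_bigr => j _; rewrite rmorphB.
have f1B y z : f (1 - y * z) = 1 - f y * f z.
  by rewrite rmorphB rmorph1 rmorphM.
have fdenom : f denominator =
    \prod_(i < n) ((1 - f a%:MP * (f \o x) i) * (1 - f b%:MP * (f \o x) i) *
                   (1 - f c%:MP * (f \o x) i)) *
    \prod_(k < n) \prod_(j < k) (1 - (f \o x) j * (f \o x) k).
  rewrite /denominator rmorphM !rmorph_prod; congr (_ * _).
    by apply: eq_bigr => i _; rewrite (rmorphM f) [f (_ * _)](rmorphM f) !f1B.
  apply: eq_bigr => k _; rewrite rmorph_prod.
  by apply: eq_bigr => j _; rewrite f1B.
have fsum : f (partial_sum (N + n) * vdm) =
    altsum (f \o x) (push_strip (f c%:MP)
      (colweight (colp (f a%:MP)) (colq (f a%:MP) (f b%:MP)))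
      : {ffun 'I_n -> 'I_(N + n)} -> Q).
  rewrite partial_sum_vdm rmorph_sum; apply: eq_bigr => al _.
  rewrite rmorphM altdet_rmorph; congr (_ * _); apply: push_strip_rmorph => k.
    by rewrite /colp; case: ifP; rewrite ?rmorph1.
  by rewrite /colq; case: k => [|k]; rewrite ?rmorph0 //; case: ifP; rewrite ?rmorphM.
have -> : partial_sum (N + n) * denominator * vdm =
          denominator * (partial_sum (N + n) * vdm).
  by rewrite mulrAC mulrC.
by rewrite rmorphM fsum fdenom fvdm (three_parameter_alternants _ _ _ xN).
Qed.

Lemma partial_sum_denominator N :
  partial_sum (N.+1 + n) * denominator * vdm - vdm \in @vanish_upto n K N.
Proof.
have [Q [f fP]] := ideal_quotient (vanish_upto_ideal n K N).
apply/fP/rmorph_partial_sum => k.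
rewrite -rmorphXn -[RHS](rmorph0 f); apply/fP.
by rewrite subr0 varX_nilpotent.
Qed.

Lemma partial_sum_approx N : exists2 M, (N <= M)%N &
  forall m, (mdeg m < N)%N ->
    (partial_sum (M + n) * denominator)@_m = (1 : {mpoly K[n]})@_m.
Proof.
pose d := (\sum_(j < n) (n - j.+1))%N.
exists (d + N).+1 => [|m ltm]; first by rewrite leqW // leq_addl.
have := partial_sum_denominator (d + N).
rewrite -{2}[vdm]mul1r -mulrBl mulrC.
move/(vanish_homog_div (vdm_neq0 _ _) (vdm_homog _ _)).
by move/vanish_uptoP/(_ m (ltnW ltm))/eqP; rewrite mcoeffB subr_eq0 => /eqP.
Qed.

Definition schur_term (lam : lenpart n) : mps n K :=
  mps_of_mpoly (fpol R (val lam) *: schur K (val lam)).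

Lemma lenpart0_proof : sorted geq (nseq_tuple n 0%N).
Proof.
apply/(sortedP 0%N) => j _; rewrite /= !nth_nseq.
by case: ifP; case: ifP.
Qed.

Definition lenpart_of N (al : {ffun 'I_n -> 'I_N}) : lenpart n :=
  insubd (exist (fun lam : n.-tuple nat => sorted geq lam) _ lenpart0_proof)
         (part_of al).

Lemma val_lenpart_of N (al : {ffun 'I_n -> 'I_N}) :
  strict al -> val (lenpart_of al) = part_of al.
Proof. by move=> sal; rewrite insubdK // unfold_in part_of_sorted. Qed.

Definition box_partitions N : seq (lenpart n) :=
  [seq lenpart_of al | al <- enum {ffun 'I_n -> 'I_N} & strict al].

Lemma box_partitions_uniq N : uniq (box_partitions N).
Proof.
rewrite map_inj_in_uniq => [|al be]; first exact: filter_uniq (enum_uniq _).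
rewrite !mem_filter => /andP[sal _] /andP[sbe _] /(congr1 val).
rewrite !val_lenpart_of // => e; apply/ffunP => j; apply: val_inj.
by rewrite /= -(part_ofE sal) -(part_ofE sbe) e.
Qed.

(** Together with [schur_term_low], this reduces every coefficient of the sum
    over all partitions to a finite sum. *)
Lemma notin_box_partitions N (lam : lenpart n) : lam \notin box_partitions (N + n) ->
  exists j, (N < tnth (val lam) j)%N.
Proof.
move=> nlam; apply/existsP; apply: contraR nlam; rewrite negb_exists => /forallP le.
have [|al sal eal] := @part_of_surj n (val lam) (N + n) (valP lam).
  by move=> j; rewrite leq_add2r leqNgt.
apply/mapP; exists al; first by rewrite mem_filter sal mem_enum.
by apply: val_inj; rewrite val_lenpart_of.
Qed.

Lemma schur_term_low (lam : lenpart n) j m :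
  (mdeg m < tnth (val lam) j)%N -> mps_coef (schur_term lam) m = 0.
Proof.
move=> ltm; have lesum i : (tnth (val lam) i <= \sum_(i < n) tnth (val lam) i)%N.
  by rewrite (bigD1 i) //= leq_addr.
have [|al sal eal] :=
  @part_of_surj n (val lam) (\sum_(i < n) tnth (val lam) i + n) (valP lam).
  by move=> i; rewrite leq_add2r.
rewrite /= mcoeffZ -eal schur_low ?mulr0 // eal.
exact: leq_trans ltm (lesum j).
Qed.

Lemma schur_term_summable : mps_summable schur_term.
Proof.
move=> m; apply: (@sub_finite_set _ _ [set` box_partitions (mdeg m + n)]); last first.
  exact: finite_seq.
move=> lam nz; apply/negP => /negP/notin_box_partitions[j /schur_term_low e].
have : mps_coef (schur_term lam) m != 0 by [].
by rewrite e eqxx.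
Qed.

Lemma mps_sum_schur_term N :
  mps_trunc_eq N.+1 (mps_sum schur_term) (partial_sum (N + n)).
Proof.
move=> m ltm; rewrite /mps_sum /= (@fsbigE _ _ _ _ _ (box_partitions (N + n))) //.
- rewrite (eq_bigl xpredT) => [|lam]; last by rewrite in_setT.
  rewrite big_map big_filter big_enum_cond /= raddf_sum.
  by apply: eq_bigr => al sal; rewrite /= val_lenpart_of.
- exact: box_partitions_uniq.
move=> lam _ /notin_box_partitions[j lt]; apply: (@schur_term_low _ j).
exact: leq_trans lt.
Qed.

Lemma mps_sum_denominator : mps_sum schur_term * mps_of_mpoly denominator = 1.
Proof.
apply: mps_truncP => N; have [M leNM e] := partial_sum_approx N.
exists (partial_sum (M + n) * denominator) => [|m ltm]; last by rewrite e // mcoeff1.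
apply: mps_trunc_mul => [m ltm|] //; apply: mps_sum_schur_term.
by rewrite ltnS ltnW // (leq_trans ltm).
Qed.

End Assembly.

Theorem theorem1 (R : idomainType) (n : nat) (hn : (1 <= n)%N) :
  let a := va R in let b := vb R in let c := vc R in
  let term (lam : lenpart n) : mps n {mpoly R[3]} :=
    mps_of_mpoly (fpol R (val lam) *: schur {mpoly R[3]} (val lam)) in
  mps_summable term /\
  mps_sum term =
    (\prod_(i < n)
       (mps_of_mpoly ((1 - a *: 'X_i) * (1 - b *: 'X_i) * (1 - c *: 'X_i)))^-1)
    * \prod_(j < n) \prod_(k < n | (j < k)%N)
        (mps_of_mpoly (1 - 'X_j * 'X_k))^-1.
Proof.
move=> a b c term; split; first exact: schur_term_summable.
have unit1B (q : {mpoly {mpoly R[3]}[n]}) :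
    q@_0%MM = 0 -> mps_of_mpoly (1 - q) \is a GRing.unit.
  by move=> q0; apply: mps_unitr; rewrite /= mcoeffB mcoeff1 eqxx q0 subr0.
set inv1 := \prod_(i < n) _; set inv2 := \prod_(j < n) _.
(* The sum is an inverse of the denominator, so it is enough that the right-hand
   side is one as well. *)
suff denomV : mps_of_mpoly (denominator R n) * (inv1 * inv2) = 1.
  by rewrite -[LHS]mulr1 -denomV mulrA mps_sum_denominator mul1r.
have coefX0 (m : 'X_{1..n}) :
    mdeg m != 0%N -> ('X_[m] : {mpoly {mpoly R[3]}[n]})@_0%MM = 0.
  by rewrite mdeg_eq0 => m0; rewrite mcoeffX (negPf m0).
have unitZ (z : {mpoly R[3]}) (i : 'I_n) :
    mps_of_mpoly (1 - z *: 'X_i) \is a GRing.unit.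
  by apply: unit1B; rewrite mcoeffZ coefX0 ?mulr0 // mdeg1.
have unitM (p q : {mpoly {mpoly R[3]}[n]}) : mps_of_mpoly p \is a GRing.unit ->
    mps_of_mpoly q \is a GRing.unit -> mps_of_mpoly (p * q) \is a GRing.unit.
  by move=> pU qU; rewrite rmorphM unitrM pU.
pose y := varX n {mpoly R[3]}.
rewrite /denominator (prod_pairs n (fun j k => 1 - y j * y k)).
rewrite rmorphM mulrACA rmorph_prod -big_split big1 => [|i _].
  rewrite mul1r rmorph_prod -big_split big1 // => j _.
  rewrite rmorph_prod -big_split big1 // => k _ /=.
  by rewrite /y !varXE mulrV // unit1B // -mpolyXD coefX0 // mdegD !mdeg1.
by rewrite /= !mul_mpolyC varXE mulrV // !unitM // unitZ.
Qed.
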